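(* Let $W_C(x)\in\mathbb C^{p\times p}[x]$ be a monic matrix polynomial of degree $N_C$ and $W_G(y)\in\mathbb C^{p\times p}[y]$ a matrix polynomial of degree $N_G$ with leading coefficient $A_{G,N_G}$ (possibly singular), with $\sigma(W_G(y))\cap\operatorname{supp}_y(u)=\varnothing$. Let $\check u_{x,y}=u_{x,y}(W_G(y))^{-1}+v_{x,y}$ with $v_{x,y}W_G(y)=0_p$, and $\hat u_{x,y}=W_C(x)\check u_{x,y}$. Assume $u$, $\check u$ and $\hat u$ are quasidefinite, and let $R_{k,l}:=\langle P^{[1]}_k(x),I_py^l\rangle_{\check u}$. Let $n\ge N_G$ and suppose the matrix $$\Phi_n=\begin{bmatrix}\boldsymbol{\mathcal J}_{C,P^{[1]}_{n-N_G}}&R_{n-N_G,0}&\dots&R_{n-N_G,n-1}\\ \vdots&\vdots&&\vdots\\ \boldsymbol{\mathcal J}_{C,P^{[1]}_{n+N_C-1}}&R_{n+N_C-1,0}&\dots&R_{n+N_C-1,n-1}\end{bmatrix}\in\mathbb C^{(N_C+N_G)p\times(N_C+n)p}$$ has full rank $(N_C+N_G)p$; let $\Phi_n^\square$ be a poised submatrix, i.e. a nonsingular submatrix formed by $(N_C+N_G)p$ columns of $\Phi_n$. Then $$\hat P^{[1]}_n(x)W_C(x)=\Theta_*\begin{bmatrix}\Phi_n^\square&\begin{matrix}P^{[1]}_{n-N_G}(x)\\ \vdots\\ P^{[1]}_{n+N_C-1}(x)\end{matrix}\\ \varphi_n^\square&P^{[1]}_{n+N_C}(x)\end{bmatrix},\qquad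 \big(\hat P^{[2]}_n(y)\big)^\top A_{G,N_G}=-\Theta_*\begin{bmatrix}\Phi_n^\square&\begin{matrix}H_{n-N_G}\\ 0_p\\ \vdots\\ 0_p\end{matrix}\\ (\varphi^K_n(y))^\square&0_p\end{bmatrix},$$ and the corresponding quasitau matrices are $$\hat H_n=\Theta_*\begin{bmatrix}\Phi_n^\square&\begin{matrix}R_{n-N_G,n}\\ \vdots\\ R_{n+N_C-1,n}\end{matrix}\\ \varphi_n^\square&R_{n+N_C,n}\end{bmatrix}=\Theta_*\begin{bmatrix}\Phi_n^\square&\begin{matrix}H_{n-N_G}\\ 0_p\\ \vdots\\ 0_p\end{matrix}\\ \varphi_n^\square&0_p\end{bmatrix}.$$
   Context: Notation. $p\ge1$ is fixed; $I_p,0_p$ are the $p\times p$ identity and zero matrices. Semi-infinite matrices are written in $p\times p$ blocks indexed by $0,1,2,\dots$; $A_{[n]}$ is the truncation to the first $n$ block rows and columns. $\chi(x)=[I_p,I_px,I_px^2,\dots]^\top$. The last quasideterminant of a block matrix with $A$ square nonsingular is $\Theta_*\begin{bmatrix}A&B\\ C&D\end{bmatrix}=D-CA^{-1}B$, with $D$ the last $p\times p$ block. Generalized kernels. $u=u_{x,y}$ is a $p\times p$ matrix of fast decreasing distributions in the real variables $(x,y)$ (distributions $w$ such that $(1+x^2+y^2)^{k/2}w$ is a bounded distribution for all $k$); the projections $\operatorname{supp}_x(u),\operatorname{supp}_y(u)$ of its support are assumed bounded. The sesquilinear form is $\big(\langle P(x),Q(y)\rangle_u\big)_{i,j}=\sum_{k,l}\langle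 (u_{x,y})_{k,l},P_{i,k}(x)Q_{j,l}(y)\rangle$, for matrix polynomials and for matrix functions smooth near the support. $\sigma(W)$ is the zero set of $\det W$. Products: $\langle P,Q\rangle_{uM(y)}=\langle P,Q(y)(M(y))^\top\rangle_u$, similarly for $u(M(y))^{-1}$, and $\langle P,Q\rangle_{M(x)u}=\langle P(x)M(x),Q\rangle_u$. Gram matrix: $G_{k,l}=\langle I_px^k,I_py^l\rangle_u$. $u$ is quasidefinite if $\det G_{[k]}\ne0$ for all $k\ge1$; then $G=S_1^{-1}HS_2^{-\top}$ uniquely, with $S_1,S_2$ lower unitriangular by blocks and $H=\operatorname{diag}(H_0,H_1,\dots)$. $P^{[i]}(x)=S_i\chi(x)$ has blocks $P^{[i]}_n$ (monic, degree $n$, $\langle P^{[1]}_n,P^{[2]}_m\rangle_u=\delta_{n,m}H_n$). The objects $\hat P^{[1]}_n,\hat P^{[2]}_n,\hat H_n$ are those of $\hat u$; the matrices $\hat H_n$ are called quasitau matrices. $K_n(x,y)=\sum_{k=0}^n(P^{[2]}_k(y))^\top H_k^{-1}P^{[1]}_k(x)$. Root spectral jets for $W_C$. Let $\sigma(W_C)=\{x_1,\dots,x_q\}$, $s_a=\dim\operatorname{Ker}W_C(x_a)$, and $\kappa^{(a)}_1\le\dots\le\kappa^{(a)}_{s_a}$ be the partial multiplicities at $x_a$ (total sum $N_Cp$). Canonical right root polynomials are fixed: columns $r^{(a)}_j(x)=\sum_{l=0}^{\kappa^{(a)}_j-1}r^{(a)}_{j,l}(x-x_a)^l$ such that $W_Cr^{(a)}_j$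 vanishes at $x_a$ to order at least $\kappa^{(a)}_j$ and $r^{(a)}_{1,0},\dots,r^{(a)}_{s_a,0}$ are linearly independent. $\boldsymbol{\mathcal J}_{C,f}\in\mathbb C^{p\times N_Cp}$ is the row, ordered lexicographically in $(a,i,m)$, of the columns $\frac{1}{m!}\frac{d^m}{dx^m}\big(f(x)r^{(a)}_i(x)\big)\big|_{x=x_a}$, $0\le m\le\kappa_i^{(a)}-1$. For functions of $(x,y)$ the jet is taken in $x$, with $y$ a parameter. For $l\in\{0,\dots,n-1\}$, $r^K_{n,l}(z):=\langle W_G(z)K_{n-1}(x,z),I_py^l\rangle_{\check u}-I_pz^l\in\mathbb C^{p\times p}[z]$. Further $$\varphi_n=\big[\boldsymbol{\mathcal J}_{C,P^{[1]}_{n+N_C}},R_{n+N_C,0},\dots,R_{n+N_C,n-1}\big],\quad \varphi^K_n(y)=\big[W_G(y)\boldsymbol{\mathcal J}_{C,K_{n-1}}(y),r^K_{n,0}(y),\dots,r^K_{n,n-1}(y)\big],$$ both with $(N_C+n)p$ columns; $\varphi_n^\square$ and $(\varphi_n^K(y))^\square$ are formed by the same selection of columns that forms $\Phi_n^\square$.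
   Formalization: The last identity is proved as \hat H_n A_{G,N_G}=Θ_*[…], because the printed \hat H_n=Θ_*[…] fails unless A_{G,N_G}=I; and N_G≥1 is assumed, because for N_G=0 the formula for \hat P^{[2]}_n is false or its quasideterminant is undefined. *)

(* Defs.v *)
From HB Require Import structures.
From mathcomp Require Import all_boot all_order all_algebra.
From mathcomp Require Import all_classical all_reals all_analysis.
From mathcomp Require Import complex.

Set Implicit Arguments.
Unset Strict Implicit.
Unset Printing Implicit Defensive.

Import Order.TTheory GRing.Theory Num.Theory.
Import numFieldNormedType.Exports.

Local Open Scope classical_set_scope.
Local Open Scope ring_scope.
Local Open Scope complex_scope.

Section Distributions.
Variable R : realType.
Local Notation C := R[i].

Implicit Types f g : R -> R -> C.

(* Continuity and derivatives of complex-valued functions of real variables are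
   taken componentwise. *)
Definition cderivable (h : R -> C) (t : R) : Prop :=
  derivable (fun s => complex.Re (h s)) t 1 /\
  derivable (fun s => complex.Im (h s)) t 1.

Definition cderive (h : R -> C) (t : R) : C :=
  derive1 (fun s => complex.Re (h s)) t +i* derive1 (fun s => complex.Im (h s)) t.

Definition partialx f : R -> R -> C := fun x y => cderive (fun t => f t y) x.
Definition partialy f : R -> R -> C := fun x y => cderive (f x) y.

Definition ccontinuous f : Prop :=
  continuous (fun z : R * R => complex.Re (f z.1 z.2)) /\
  continuous (fun z : R * R => complex.Im (f z.1 z.2)).

Fixpoint Ck (k : nat) f : Prop :=
  ccontinuous f /\
  if k is k'.+1 then
    [/\ forall x y, cderivable (fun t => f t y) x /\ cderivable (f x) y,
        Ck k' (partialx f) & Ck k' (partialy f)]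
  else True.

Definition smooth f : Prop := forall k, Ck k f.

Definition fsupp f : set (R * R) := closure [set z | f z.1 z.2 != 0].

Definition test_fun f : Prop := smooth f /\ compact (fsupp f).

Definition partials (a b : nat) f : R -> R -> C :=
  iter a partialx (iter b partialy f).

Definition cabs (z : C) : R := complex.Re `|z|.

(* A functional is applied to arbitrary functions for typing convenience only:
   its values outside the test functions are never constrained nor used.
   Continuity on the test function space is expressed by the usual seminorm
   estimates on each compact set. *)
Record schwartz_distribution := SchwartzDistribution {
  dapp :> (R -> R -> C) -> C;
  dapp_linear : forall (c : C) f g, test_fun f -> test_fun g ->
    dapp (fun x y => c * f x y + g x y) = c * dapp f + dapp g;
  dapp_continuous : forall K : set (R * R), compact K ->
    exists (c : R) (m : nat), forall f (B : R),
      test_fun f -> fsupp f `<=` K ->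
      (forall a b x y, (a + b <= m)%N -> cabs (partials a b f x y) <= B) ->
      cabs (dapp f) <= c * B }.

Definition vanishes_on (w : schwartz_distribution) (U : set (R * R)) :
    Prop :=
  forall f, test_fun f -> fsupp f `<=` U -> w f = 0.

Definition dsupp (w : schwartz_distribution) : set (R * R) :=
  ~` (\bigcup_(U in [set U | open U /\ vanishes_on w U]) U).

(* Bounded distributions: the dual of the space of smooth functions all of
   whose derivatives are integrable, in which test functions are dense. *)
Definition bounded_distribution (w : (R -> R -> C) -> C) : Prop :=
  exists (c : R) (m : nat), forall f, test_fun f ->
    ((cabs (w f))%:E <=
     c%:E * \sum_(a < m.+1) \sum_(b < m.+1)
       \int[(@lebesgue_measure R \x @lebesgue_measure R)%E]_z
         (cabs (partials a b f z.1 z.2))%:E)%E.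

Definition fast_decreasing (w : schwartz_distribution) : Prop :=
  forall k : nat, bounded_distribution
    (fun f => w (fun x y =>
       ((1 + x ^+ 2 + y ^+ 2) `^ (k%:R / 2))%:C * f x y)).

Definition agree_near (A : set (R * R)) f g : Prop :=
  exists U : set (R * R),
    [/\ open U, A `<=` U & forall z, U z -> f z.1 z.2 = g z.1 z.2].

(* Pairing of a compactly supported distribution with a function that is only
   smooth near its support: the common value of [w] on all test functions that
   coincide with [f] near the support of [w]. *)
Definition kpair (w : schwartz_distribution) f : C :=
  w (xget (fun _ _ => 0) [set g | test_fun g /\ agree_near (dsupp w) f g]).

End Distributions.

Section MatrixKernels.
Variables (R : realType) (p : nat).
Local Notation C := R[i].
Local Notation mpoly := 'M[{poly C}]_p.

Definition meval m n (W : 'M[{poly C}]_(m, n)) (z : C) : 'M[C]_(m, n) :=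
  \matrix_(i, j) (W i j).[z].

Definition mcoef (W : mpoly) (k : nat) : 'M[C]_p := \matrix_(i, j) (W i j)`_k.

Definition spectrum (W : mpoly) : set C := [set z | \det (meval W z) = 0].

(* [A] is allowed to be singular, only [A != 0] is required. *)
Definition has_deg_lead (W : mpoly) (N : nat) (A : 'M[C]_p) : Prop :=
  [/\ mcoef W N = A, A != 0 & forall k, (N < k)%N -> mcoef W k = 0].

Definition monic_deg (W : mpoly) (N : nat) : Prop := has_deg_lead W N 1%:M.

Definition msupp (u : 'M[schwartz_distribution R]_p) : set (R * R) :=
  \bigcup_(ij in [set: 'I_p * 'I_p]) dsupp (u ij.1 ij.2).

Definition suppx u : set R := fst @` msupp u.
Definition suppy u : set R := snd @` msupp u.

Definition generalized_kernel (u : 'M[schwartz_distribution R]_p) : Prop :=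
  [/\ forall i j, fast_decreasing (u i j),
      bounded_set (suppx u) & bounded_set (suppy u)].

Definition matfun : Type := R -> 'M[C]_p.
Definition sform : Type := matfun -> matfun -> 'M[C]_p.

Definition mpfun (W : mpoly) : matfun := fun x => meval W x%:C.
Definition monomial (k : nat) : matfun := fun x => (x%:C ^+ k)%:M.

Definition kform (u : 'M[schwartz_distribution R]_p) : sform := fun P Q =>
  \matrix_(i, j) \sum_k \sum_l kpair (u k l) (fun x y => P x i k * Q y j l).

Definition formMr (F : sform) (M : matfun) : sform :=
  fun P Q => F P (fun y => Q y *m (M y)^T).
Definition formMl (M : matfun) (F : sform) : sform :=
  fun P Q => F (fun x => P x *m M x) Q.
Definition formD (F1 F2 : sform) : sform := fun P Q => F1 P Q + F2 P Q.

(* v M(y) = 0 entrywise, as distributions: (v M)_{ij} = sum_l M_{lj}(y) v_{il}. *)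
Definition annihilated_by (v : 'M[schwartz_distribution R]_p) (M : matfun) :
    Prop :=
  forall (i j : 'I_p) (f : R -> R -> C), test_fun f ->
    \sum_l v i l (fun x y => M y l j * f x y) = 0.

(* The form of u (W_G(y))^-1 + v. Real zeros of det W_G lie off the support of
   u in y, hence the value of [invmx] there is irrelevant. *)
Definition geronimus_form (u v : 'M[schwartz_distribution R]_p) (WG : mpoly) :
    sform :=
  formD (formMr (kform u) (fun y => invmx (mpfun WG y))) (kform v).

Definition bmx : Type := nat -> nat -> 'M[C]_p.

Definition btrunc (A : bmx) (n : nat) : 'M[C]_(\sum_(i < n) p) :=
  \mxblock_(i < n, j < n) A i j.

Definition bdiag (H : nat -> 'M[C]_p) : bmx :=
  fun k l => if k == l then H k else 0.

Definition block_unitriangular (S : bmx) : Prop :=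
  (forall k, S k k = 1%:M) /\ (forall k l, (k < l)%N -> S k l = 0).

Definition gram (F : sform) : bmx := fun k l => F (monomial k) (monomial l).

Definition quasidefinite (F : sform) : Prop :=
  forall k, (0 < k)%N -> \det (btrunc (gram F) k) != 0.

(* G = S1^-1 H S2^-T. The factors being lower triangular, diagonal and upper
   triangular by blocks, truncation commutes with the inverses and with the
   products on the right-hand side. *)
Definition gauss_borel (G S1 : bmx) (H : nat -> 'M[C]_p) (S2 : bmx) : Prop :=
  [/\ block_unitriangular S1, block_unitriangular S2 &
      forall n, btrunc G n =
        invmx (btrunc S1 n) *m btrunc (bdiag H) n *m (invmx (btrunc S2 n))^T].

(* The n-th block of S chi(x), for S block lower triangular. *)
Definition bop (S : bmx) (n : nat) : mpoly :=
  \sum_(k < n.+1) 'X^k *: map_mx polyC (S n k).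

(* K_n(x,y) as a polynomial in x, for a fixed value of y. *)
Definition CDkernel (S1 : bmx) (H : nat -> 'M[C]_p) (S2 : bmx) (n : nat)
    (y : C) : mpoly :=
  \sum_(k < n.+1)
    map_mx polyC ((meval (bop S2 k) y)^T *m invmx (H k)) *m bop S1 k.

(* Candidate root data: the points of the spectrum, the numbers and orders of
   the root polynomials, and the coefficients of the latter in powers of
   x - x_a. *)
Record root_data := RootData {
  rd_q : nat;
  rd_pt : 'I_rd_q -> C;
  rd_s : 'I_rd_q -> nat;
  rd_kappa : forall a, 'I_(rd_s a) -> nat;
  rd_coef : forall a, 'I_(rd_s a) -> nat -> 'cV[C]_p }.

Definition root_poly (D : root_data) (a : 'I_(rd_q D)) (j : 'I_(rd_s a)) :
    'cV[{poly C}]_p :=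
  \sum_(l < rd_kappa j)
    ('X - (rd_pt a)%:P) ^+ l *: map_mx polyC (rd_coef j l).

(* Local Smith form at z: the nonzero exponents are the [kappa j], the
   remaining p - s ones (for which [nth] returns its default value) vanish. *)
Definition partial_multiplicities (W : mpoly) (z : C) (s : nat)
    (kappa : 'I_s -> nat) : Prop :=
  [/\ (s <= p)%N, forall j, (0 < kappa j)%N,
      forall i j : 'I_s, (i <= j)%N -> (kappa i <= kappa j)%N &
      exists E F : mpoly,
        [/\ \det (meval E z) != 0, \det (meval F z) != 0 &
            W = E *m diag_mx (\row_(i < p)
                  ('X - z%:P) ^+ nth 0%N (codom kappa) i) *m F]].

Definition canonical_root_data (W : mpoly) (N : nat) (D : root_data) : Prop :=
  [/\ injective (@rd_pt D) /\ spectrum W = range (@rd_pt D),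
      forall a : 'I_(rd_q D), rd_s a = (p - \rank (meval W (rd_pt a)))%N,
      (forall a : 'I_(rd_q D),
         partial_multiplicities W (rd_pt a) (@rd_kappa D a)) /\
      (\sum_(a < rd_q D) \sum_(j < rd_s a) rd_kappa j)%N = (N * p)%N,
      forall (a : 'I_(rd_q D)) (j : 'I_(rd_s a)) (i : 'I_p),
        ('X - (rd_pt a)%:P) ^+ rd_kappa j %| (W *m root_poly j) i 0 &
      forall a : 'I_(rd_q D),
        row_free (\matrix_(j < rd_s a) (rd_coef j 0)^T)].

Definition jet_dim (D : root_data) : nat :=
  (\sum_(a < rd_q D) \sum_(j < rd_s a) rd_kappa j)%N.

Definition jet (D : root_data) (f : mpoly) : 'M[C]_(p, jet_dim D) :=
  \mxrow_(a < rd_q D) \mxrow_(j < rd_s a)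
    \matrix_(i < p, m < rd_kappa j) ((f *m root_poly j) i 0)^`N(m).[rd_pt a].

Definition quasidet m k l (A : 'M[C]_m) (B : 'M[C]_(m, l))
    (C0 : 'M[C]_(k, m)) (D : 'M[C]_(k, l)) : 'M[C]_(k, l) :=
  D - C0 *m invmx A *m B.

Definition Rmat (F : sform) (S1 : bmx) (k l : nat) : 'M[C]_p :=
  F (mpfun (bop S1 k)) (monomial l).

Definition rK (F : sform) (WG : mpoly) (S1 : bmx) (H : nat -> 'M[C]_p)
    (S2 : bmx) (n l : nat) (z : C) : 'M[C]_p :=
  F (fun x => meval WG z *m mpfun (CDkernel S1 H S2 n.-1 z) x) (monomial l)
  - (z ^+ l)%:M.

Definition jetR_row (D : root_data) (F : sform) (S1 : bmx) (n k : nat) :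
    'M[C]_(p, jet_dim D + \sum_(l < n) p) :=
  row_mx (jet D (bop S1 k)) (\mxrow_(l < n) Rmat F S1 k l).

Definition Phi (D : root_data) (F : sform) (S1 : bmx) (NC NG n : nat) :
    'M[C]_(\sum_(i < NC + NG) p, jet_dim D + \sum_(l < n) p) :=
  \mxcol_(i < NC + NG) jetR_row D F S1 n (n - NG + i).

Definition phiK (D : root_data) (F : sform) (WG : mpoly) (S1 : bmx)
    (H : nat -> 'M[C]_p) (S2 : bmx) (n : nat) (y : C) :
    'M[C]_(p, jet_dim D + \sum_(l < n) p) :=
  row_mx (meval WG y *m jet D (CDkernel S1 H S2 n.-1 y))
         (\mxrow_(l < n) rK F WG S1 H S2 n l y).

End MatrixKernels.

(* Main.v *)
Require Import Defs.
From HB Require Import structures.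
From mathcomp Require Import all_boot all_order all_algebra.
From mathcomp Require Import all_classical all_reals all_analysis.
From mathcomp Require Import complex ring lra.

(** The formulas express the connection coefficients between the biorthogonal
    polynomials of [u] and those of uhat = W_C ucheck, where u = ucheck W_G.

    Write <.,.> for the form of ucheck, so that <P, Q>_u = <P, Q W_G^T> and
    <P, Q>_uhat = <P W_C, Q>.  The polynomial T = hat P_n W_C has degree n + N_C and
    <T, P_j>_u = <hat P_n, P_j W_G^T>_uhat vanishes for j + N_G < n.  Hence T is a
    combination of P_(n - N_G), ..., P_(n + N_C), monic in the last one
    ([window_expansion]).  Its jets along the root polynomials of W_C vanish because
    W_C kills the latter to the required order ([jet_mul0]), and its moments against
    y^l vanish for l < n and equal hat H_n for l = n.  The jets and the first n
    moments are linear conditions 0 = phi + t Phi on the row t of the remaining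
    coefficients, so t = - phi Phi^-1 on any nonsingular selection of columns
    ([first_kind_window]).  Evaluating at x, taking the n-th moment and computing
    <T, P_(n - N_G)>_u give the formulas for hat P_n W_C, hat H_n and hat H_n A.

    For the second family the same expansion is applied to the polynomial in x
    W_G(y) K_(n-1)(x, y) - hat K_(n-1)(x, y) W_C(x).  By the reproducing properties
    its coefficients vanish below n - N_G, the coefficient there satisfies
    t_0 H_(n - N_G) = hat P_n(y)^T A, the coefficient at n + N_C is 0, and its jets and
    moments form the row [phiK] ([second_kind_window]).

    The analytic input is that the forms are bilinear over constant matrices and
    that u = ucheck W_G holds for them ([geronimus_linl], [geronimus_linr],
    [kform_geronimus]).  Pairings are defined through test functions agreeing with
    the integrand near the support, so this rests on two facts: a function smooth
    near a compact support agrees near it with a test function ([test_near]), and a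
    distribution vanishes on test functions supported off its support
    ([dapp_off_dsupp]).  Both use plateau functions built from exp(-1/t), as does
    the replacement of 1 / det W_G, whose zeros avoid the support of [u], by a
    globally smooth function ([smooth_inv_away]). *)

Set Implicit Arguments.
Unset Strict Implicit.
Unset Printing Implicit Defensive.

Import Order.TTheory GRing.Theory Num.Theory.
Import numFieldNormedType.Exports.

Local Open Scope classical_set_scope.
Local Open Scope ring_scope.
Local Open Scope complex_scope.

(** * Smooth functions of two real variables *)

Section Flat.
Variable R : realType.

(** The functions t^-m exp(-1/t), extended by 0 to t <= 0.  Taking all m at once
    makes the family stable under differentiation, so that smoothness of
    exp(-1/t) follows from one computation of a first derivative. *)
Definition flat (m : nat) (t : R) : R :=
  if 0 < t then t^-1 ^+ m * expR (- t^-1) else 0.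

Lemma flat_le0 m t : t <= 0 -> flat m t = 0.
Proof. by rewrite /flat ltNge => ->. Qed.

Lemma flat_gt0 m t : 0 < t -> 0 < flat m t.
Proof.
by move=> t0; rewrite /flat t0 mulr_gt0 ?exprn_gt0 ?invr_gt0 ?expR_gt0.
Qed.

Lemma flat_ge0 m t : 0 <= flat m t.
Proof. by case: (ltP 0 t) => [/(flat_gt0 m)/ltW//|/(flat_le0 m) ->]. Qed.

(** The Taylor lower bound exp(x) >= x^(m+2)/(m+2)! at x = 1/t; being O(t^2) at 0
    is what makes the derivative at 0 exist and vanish. *)
Lemma flat_quadratic m t : flat m t <= (m.+2)`!%:R * t ^+ 2.
Proof.
case: (ltP 0 t) => t0; last by rewrite flat_le0 // mulr_ge0 // sqr_ge0.
rewrite /flat t0; set x := t^-1.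
have x0 : 0 < x by rewrite invr_gt0.
have -> : t = x^-1 by rewrite /x invrK.
clearbody x; clear t t0.
have F0 : 0 < (m.+2)`!%:R :> R by rewrite ltr0n fact_gt0.
have := expR_ge1Dxn m.+1 (ltW x0); set f := (m.+2)`!%:R => E.
have {}E : x ^+ m.+2 <= f * expR x.
  by rewrite mulrC -ler_pdivrMr //; apply: le_trans E; rewrite lerDr.
rewrite expRN ler_pdivrMr ?expR_gt0 // exprVn mulrAC.
by rewrite ler_pdivlMr ?exprn_gt0 // -exprD addn2.
Qed.

Lemma is_derive_flat m t :
  is_derive t (1 : R) (flat m) (flat m.+2 t - m%:R * flat m.+1 t).
Proof.
case: (ltgtP t 0) => t0.
- rewrite !flat_le0 ?ltW // mulr0 subr0.
  apply: (@near_eq_is_derive _ _ _ (cst 0)).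
  by near=> s; rewrite flat_le0 ?ltW //; near: s; exact: lt_nbhsl t0.
- have tn0 : t != 0 by rewrite gt_eqF.
  apply: (@near_eq_is_derive _ _ _
    (fun s : R => s^-1 ^+ m * expR (- s^-1))).
    near=> s; rewrite /flat ifT //; near: s; exact: lt_nbhsr t0.
  have dV : is_derive t (1 : R) (fun s : R => s^-1) (- t ^- 2 *: 1).
    by apply: is_deriveV.
  have dE : is_derive t (1 : R) (fun s : R => expR (- s^-1))
      (expR (- t^-1) * (- (- t ^- 2 *: 1))).
    apply: (@is_derive1_comp _ expR (fun s => - s^-1)).
  have dX := is_deriveX m dV; rewrite exprfctE in dX.
  have dM := is_deriveM dX dE; rewrite mulrfctE in dM.
  apply: (is_derive_eq dM); clear dM dX.
  rewrite /flat t0 /GRing.scale /= -!exprVn.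
  set ex := expR _; set u := t^-1.
  by case: m => [|m]; rewrite /= ?mulr0n !exprS ?expr0 -?[m.+1%:R]natr1; ring.
- rewrite t0 (flat_le0 m.+2 (lexx 0)) (flat_le0 m.+1 (lexx 0)) mulr0 subr0.
  have cv : (fun h : R => h^-1 *: ((flat m \o shift 0) (h *: 1) - flat m 0))
     @ 0^' --> (0 : R).
    apply/cvgr0Pnorm_lt => e e0; set f : R := (m.+2)`!%:R.
    have f0 : 0 < f by rewrite ltr0n fact_gt0.
    near=> h; rewrite /= addr0 /GRing.scale /= mulr1 (flat_le0 m (lexx 0)) subr0.
    have h0 : 0 < `|h| by rewrite normr_gt0; near: h; exact: nbhs_dnbhs_neq.
    rewrite normrM normfV ltr_pdivrMl // ger0_norm ?flat_ge0 //.
    apply: le_lt_trans (flat_quadratic m h) _; rewrite -/f -real_normK ?num_real //.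
    rewrite expr2 mulrCA ltr_pM2l // -ltr_pdivlMl // mulrC.
    near: h; apply: dnbhs0_lt; exact: divr_gt0.
  apply: DeriveDef; first by apply/cvg_ex; exists 0.
  exact: cvg_lim cv.
Unshelve. all: by end_near. Qed.

End Flat.

Section RealSmooth.
Variable R : realType.
Implicit Types f g : R -> R -> R.

Definition dx f : R -> R -> R := fun x y => derive1 (fun t => f t y) x.
Definition dy f : R -> R -> R := fun x y => derive1 (f x) y.

(** Real counterpart of [Ck]: a complex function is [Ck] exactly when its two
    components are [RCk] (see [CkE]), and closure properties are easier to prove
    one real component at a time. *)
Fixpoint RCk (k : nat) f : Prop :=
  continuous (fun z : R * R => f z.1 z.2) /\
  if k is k'.+1 then
    [/\ forall x y, derivable (fun t => f t y) x 1 /\ derivable (f x) y 1,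
        RCk k' (dx f) & RCk k' (dy f)]
  else True.

Arguments RCk : simpl never.

Lemma RCk_cont k f : RCk k f -> continuous (fun z : R * R => f z.1 z.2).
Proof. by case: k => [|k] []. Qed.

Lemma RCkS k f fx fy : continuous (fun z : R * R => f z.1 z.2) ->
  (forall x y, is_derive x (1 : R) (fun t => f t y) (fx x y)) ->
  (forall x y, is_derive y (1 : R) (f x) (fy x y)) ->
  RCk k fx -> RCk k fy -> RCk k.+1 f.
Proof.
move=> cf fxP fyP kx ky; split=> //.
have -> : dx f = fx.
  by apply/funext => x; apply/funext => y; rewrite /dx derive1E; case: (fxP x y).
have -> : dy f = fy.
  by apply/funext => x; apply/funext => y; rewrite /dy derive1E; case: (fyP x y).
split=> [x y||]; [split|exact: kx|exact: ky].
- by case: (fxP x y).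
- by case: (fyP x y).
Qed.

Lemma RCk_is_derivex k f x y :
  RCk k.+1 f -> is_derive x (1 : R) (fun t => f t y) (dx f x y).
Proof.
move=> [_ [/(_ x y)[d _] _ _]]; rewrite /dx derive1E; exact: derivableP.
Qed.

Lemma RCk_is_derivey k f x y : RCk k.+1 f -> is_derive y (1 : R) (f x) (dy f x y).
Proof.
move=> [_ [/(_ x y)[_ d] _ _]]; rewrite /dy derive1E; exact: derivableP.
Qed.

Lemma RCkW k f : RCk k.+1 f -> RCk k f.
Proof.
elim: k f => [|k IH] f [cf [d kx ky]]; first by split.
split; [exact: cf|split; [exact: d|exact: (IH _ kx)|exact: (IH _ ky)]].
Qed.

Lemma RCk_cst k (c : R) : RCk k (fun _ _ => c).
Proof.
have cc (d : R) : continuous (fun z : R * R => d) by exact: cst_continuous.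
elim: k c => [|k IH] c; first by split; [exact: cc|].
exact: (RCkS (cc c) (fun x y => is_derive_cst c x 1)
  (fun x y => is_derive_cst c y 1) (IH 0) (IH 0)).
Qed.

Lemma RCk_x k : RCk k (fun x _ => x).
Proof.
have c : continuous (fun z : R * R => z.1) by move=> z; exact: cvg_fst.
case: k => [|k]; first by split; [exact: c|].
exact: (RCkS c (fun x y => is_derive_id x 1)
  (fun x y => is_derive_cst x y 1) (RCk_cst k 1) (RCk_cst k 0)).
Qed.

Lemma RCk_y k : RCk k (fun _ y => y).
Proof.
have c : continuous (fun z : R * R => z.2) by move=> z; exact: cvg_snd.
case: k => [|k]; first by split; [exact: c|].
exact: (RCkS c (fun x y => is_derive_cst y x 1)
  (fun x y => is_derive_id y 1) (RCk_cst k 0) (RCk_cst k 1)).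
Qed.

Lemma RCk_partialx k f : RCk k.+1 f -> RCk k (dx f).
Proof. by case=> _ []. Qed.

Lemma RCk_partialy k f : RCk k.+1 f -> RCk k (dy f).
Proof. by case=> _ []. Qed.

Lemma RCkD k f g : RCk k f -> RCk k g -> RCk k (fun x y => f x y + g x y).
Proof.
elim: k f g => [|k IH] f g Hf Hg; have c z := continuousD
  (RCk_cont Hf (x := z)) (RCk_cont Hg (x := z)).
  by split; [exact: c|].
exact: (RCkS c
  (fun x y => is_deriveD (RCk_is_derivex x y Hf) (RCk_is_derivex x y Hg))
  (fun x y => is_deriveD (RCk_is_derivey x y Hf) (RCk_is_derivey x y Hg))
  (IH _ _ (RCk_partialx Hf) (RCk_partialx Hg))
  (IH _ _ (RCk_partialy Hf) (RCk_partialy Hg))).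
Qed.

Lemma RCkM k f g : RCk k f -> RCk k g -> RCk k (fun x y => f x y * g x y).
Proof.
elim: k f g => [|k IH] f g Hf Hg; have c z := continuousM
  (RCk_cont Hf (x := z)) (RCk_cont Hg (x := z)).
  by split; [exact: c|].
exact: (RCkS c
  (fun x y => is_deriveM (RCk_is_derivex x y Hf) (RCk_is_derivex x y Hg))
  (fun x y => is_deriveM (RCk_is_derivey x y Hf) (RCk_is_derivey x y Hg))
  (RCkD (IH _ _ (RCkW Hf) (RCk_partialx Hg)) (IH _ _ (RCkW Hg) (RCk_partialx Hf)))
  (RCkD (IH _ _ (RCkW Hf) (RCk_partialy Hg)) (IH _ _ (RCkW Hg) (RCk_partialy Hf)))).
Qed.

Lemma RCkN k f : RCk k f -> RCk k (fun x y => - f x y).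
Proof.
move=> Hf; have := RCkM (RCk_cst k (-1)) Hf.
by under eq_fun do under eq_fun do rewrite mulN1r.
Qed.

Lemma flat_continuous m : continuous (@flat R m).
Proof.
move=> t; apply: differentiable_continuous; apply/derivable1_diffP.
by case: (is_derive_flat m t).
Qed.

(** Chain rule; the induction is on [k] for all [m] simultaneously because the
    derivative of [flat m] involves [flat m.+1] and [flat m.+2]. *)
Lemma RCk_flat k m f : RCk k f -> RCk k (fun x y => flat m (f x y)).
Proof.
elim: k m f => [|k IH] m f Hf; have c z := continuous_comp
  (RCk_cont Hf (x := z)) (@flat_continuous m _).
  by split; [exact: c|].
have kF : RCk k (fun x y => flat m.+2 (f x y) - m%:R * flat m.+1 (f x y)).
  exact: (RCkD (IH _ _ (RCkW Hf))
    (RCkN (RCkM (RCk_cst _ _) (IH _ _ (RCkW Hf))))).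
exact: (RCkS c
  (fun x y => is_derive1_comp (is_derive_flat m (f x y)) (RCk_is_derivex x y Hf))
  (fun x y => is_derive1_comp (is_derive_flat m (f x y)) (RCk_is_derivey x y Hf))
  (RCkM kF (RCk_partialx Hf)) (RCkM kF (RCk_partialy Hf))).
Qed.

Lemma RCkV k f : (forall x y, f x y != 0) -> RCk k f ->
  RCk k (fun x y => (f x y)^-1).
Proof.
move=> f0; elim: k => [|k IH] Hf; have c z := continuousV (f0 z.1 z.2)
  (RCk_cont Hf (x := z)).
  by split; [exact: c|].
have kF : RCk k (fun x y => - f x y ^- 2).
  under eq_fun do under eq_fun do rewrite -exprVn expr2.
  exact: (RCkN (RCkM (IH (RCkW Hf)) (IH (RCkW Hf)))).
exact: (RCkS c
  (fun x y => is_deriveV (f0 x y) (RCk_is_derivex x y Hf))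
  (fun x y => is_deriveV (f0 x y) (RCk_is_derivey x y Hf))
  (RCkM kF (RCk_partialx Hf)) (RCkM kF (RCk_partialy Hf))).
Qed.

Lemma CkE k (f : R -> R -> R[i]) :
  Ck k f <-> RCk k (fun x y => complex.Re (f x y)) /\
             RCk k (fun x y => complex.Im (f x y)).
Proof.
elim: k f => [|k IH] f; first by split=> [[[]]|[[? _] [? _]]].
split.
  move=> [[c1 c2] [d /IH[rx ix] /IH[ry iy]]]; split.
    exact: (conj c1 (And3 (fun x y => conj (d x y).1.1 (d x y).2.1) rx ry)).
  exact: (conj c2 (And3 (fun x y => conj (d x y).1.2 (d x y).2.2) ix iy)).
move=> [[c1 [d1 rx ry]] [c2 [d2 ix iy]]].
have Hx : Ck k (partialx f) by apply/(IH (partialx f)); exact: conj rx ix.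
have Hy : Ck k (partialy f) by apply/(IH (partialy f)); exact: conj ry iy.
exact: (conj (conj c1 c2) (And3 (fun x y =>
  conj (conj (d1 x y).1 (d2 x y).1) (conj (d1 x y).2 (d2 x y).2)) Hx Hy)).
Qed.

End RealSmooth.

Section ComplexSmooth.
Variable R : realType.
Local Notation C := R[i].
Implicit Types (f g : R -> R -> C) (r : R -> R -> R).

Lemma smoothP f : smooth f <-> forall k,
  RCk k (fun x y => complex.Re (f x y)) /\ RCk k (fun x y => complex.Im (f x y)).
Proof. by split=> H k; apply/CkE; exact: H. Qed.

Lemma smooth_cst (c : C) : smooth (fun _ _ : R => c).
Proof. by apply/smoothP => k; split; exact: RCk_cst. Qed.

Lemma smooth_real r : (forall k, RCk k r) -> smooth (fun x y => (r x y)%:C).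
Proof. by move=> H; apply/smoothP => k; split; [exact: H|exact: RCk_cst]. Qed.

Lemma smoothD f g : smooth f -> smooth g -> smooth (fun x y => f x y + g x y).
Proof.
move=> /smoothP Hf /smoothP Hg; apply/smoothP => k.
have [f1 f2] := Hf k; have [g1 g2] := Hg k.
split.
  under eq_fun do under eq_fun do rewrite raddfD /=.
  exact: RCkD f1 g1.
under eq_fun do under eq_fun do rewrite raddfD /=.
exact: RCkD f2 g2.
Qed.

Lemma complex_ReM (a b : C) : complex.Re (a * b) =
  complex.Re a * complex.Re b + - (complex.Im a * complex.Im b).
Proof. by case: a b => [? ?] [? ?]. Qed.

Lemma complex_ImM (a b : C) : complex.Im (a * b) =
  complex.Re a * complex.Im b + complex.Im a * complex.Re b.
Proof. by case: a b => [? ?] [? ?]. Qed.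

Lemma complex_ReJ (a : C) : complex.Re a^*%C = complex.Re a.
Proof. by case: a. Qed.

Lemma complex_ImJ (a : C) : complex.Im a^*%C = - complex.Im a.
Proof. by case: a. Qed.

Lemma smoothM f g : smooth f -> smooth g -> smooth (fun x y => f x y * g x y).
Proof.
move=> /smoothP Hf /smoothP Hg; apply/smoothP => k.
have [f1 f2] := Hf k; have [g1 g2] := Hg k.
split.
  under eq_fun do under eq_fun do rewrite complex_ReM.
  exact: (RCkD (RCkM f1 g1) (RCkN (RCkM f2 g2))).
under eq_fun do under eq_fun do rewrite complex_ImM.
exact: (RCkD (RCkM f1 g2) (RCkM f2 g1)).
Qed.

Lemma smooth_horner (P : {poly C}) f :
  smooth f -> smooth (fun x y => P.[f x y]).
Proof.
move=> Hf; elim/poly_ind: P => [|P c IH].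
  under eq_fun do under eq_fun do rewrite horner0.
  exact: smooth_cst.
under eq_fun do under eq_fun do rewrite hornerMXaddC.
exact: smoothD (smoothM IH Hf) (smooth_cst c).
Qed.

Lemma smooth_x : smooth (fun x _ : R => x%:C).
Proof. by apply: (@smooth_real (fun x _ => x)) => k; exact: RCk_x. Qed.

Lemma smooth_y : smooth (fun _ y : R => y%:C).
Proof. by apply: (@smooth_real (fun _ y => y)) => k; exact: RCk_y. Qed.

(** With q = |f|^2, the function conj f / (q + flat (e - q)) has a positive
    denominator everywhere, and the correction term vanishes where q >= e.  It
    serves to replace 1 / det W_G by a globally smooth function. *)
Lemma smooth_inv_away f (e : R) : 0 < e -> smooth f ->
  exists2 g, smooth g &
    forall x y, e <= complex.Re (f x y) ^+ 2 + complex.Im (f x y) ^+ 2 ->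
      g x y = (f x y)^-1.
Proof.
move=> e0 /smoothP Hf.
pose q x y := complex.Re (f x y) * complex.Re (f x y) +
              complex.Im (f x y) * complex.Im (f x y).
have qk k : RCk k q.
  have [f1 f2] := Hf k; exact: RCkD (RCkM f1 f1) (RCkM f2 f2).
have q0 x y : 0 <= q x y by rewrite addr_ge0 // -expr2 sqr_ge0.
pose d x y := q x y + flat 0 (e + - q x y).
have d0 x y : d x y != 0.
  rewrite gt_eqF // /d; case: (ltP 0 (q x y)) => qp.
    by rewrite ltr_pwDl // flat_ge0.
  by rewrite ltr_wpDl // flat_gt0 // subr_gt0 (le_lt_trans qp).
have dk k : RCk k d.
  exact: (RCkD (qk k) (RCk_flat _ (RCkD (RCk_cst k e) (RCkN (qk k))))).
exists (fun x y => (f x y)^*%C * ((d x y)^-1)%:C).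
  apply: smoothM; last by apply: smooth_real => k; exact: RCkV.
  apply/smoothP => k; have [f1 f2] := Hf k; split.
    by under eq_fun do under eq_fun do rewrite complex_ReJ.
  under eq_fun do under eq_fun do rewrite complex_ImJ.
  exact: RCkN.
move=> x y; rewrite !expr2 -/(q x y) => eq.
have qp : 0 < q x y by exact: lt_le_trans eq.
rewrite /d flat_le0 ?subr_le0 // addr0.
have zz : f x y * (f x y)^*%C = (q x y)%:C.
  apply/eqP; rewrite eq_complex /= complex_ReM complex_ImM complex_ReJ complex_ImJ /q.
  rewrite !mulrN opprK eqxx /=.
  by rewrite mulrC addNr.
have z0 : f x y != 0.
  by apply: contraTneq qp => f0; rewrite /q f0 /= mul0r addr0 ltxx.
apply: (mulfI z0); rewrite mulrA zz mulfV // fmorphV mulfV //.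
by rewrite fmorph_eq0 gt_eqF.
Qed.

End ComplexSmooth.

(** * Cutoffs *)

Section Cutoffs.
Variable R : realType.
Local Notation C := R[i].
Implicit Types (f g : R -> R -> C) (w : schwartz_distribution R).

(** The usual smooth step g(s) / (g(s) + g(1 - s)), g(s) = exp(-1/s), evaluated at
    s = 2 - (t - a)^2 / r^2: it is 1 for |t - a| <= r and 0 for |t - a| >= 2 r. *)
Definition cutoff (a r t : R) : R :=
  let s := 2 + - ((t + - a) * (t + - a) * (r * r)^-1) in
  flat 0 s * (flat 0 s + flat 0 (1 + - s))^-1.

Lemma flat_partition_neq0 (s : R) : flat 0 s + flat 0 (1 + - s) != 0.
Proof.
rewrite gt_eqF //; case: (ltP 0 s) => s0.
  by rewrite ltr_pwDl ?flat_gt0 ?flat_ge0.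
by rewrite ltr_wpDl ?flat_ge0 ?flat_gt0 // subr_gt0 (le_lt_trans s0).
Qed.

Lemma RCk_cutoff k (h : R -> R -> R) a r : RCk k h ->
  RCk k (fun x y => cutoff a r (h x y)).
Proof.
move=> Hh; rewrite /cutoff.
have Hd := RCkD Hh (RCk_cst k (- a)).
have Hs := RCkD (RCk_cst k 2) (RCkN (RCkM (RCkM Hd Hd) (RCk_cst k (r * r)^-1))).
apply: RCkM; first exact: RCk_flat.
apply: RCkV; first by move=> x y; exact: flat_partition_neq0.
exact: (RCkD (RCk_flat _ Hs) (RCk_flat _ (RCkD (RCk_cst k 1) (RCkN Hs)))).
Qed.

Lemma cutoff1 a r t : 0 < r -> `|t - a| <= r -> cutoff a r t = 1.
Proof.
move=> r0 tr; rewrite /cutoff; set s := 2 + - _.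
have s1 : 1 <= s.
  rewrite lerBrDr -lerBrDl -[2 - 1]/(1 + 1 - 1) addrK.
  rewrite ler_pdivrMr ?mulr_gt0 // mul1r -!expr2 -[X in X ^+ 2 <= _]/(t - a).
  by rewrite -real_normK ?num_real // ler_pXn2r // nnegrE ltW.
have s0 : 0 < s by exact: lt_le_trans s1.
by rewrite [flat 0 (1 + - s)]flat_le0 ?subr_le0 // addr0 mulfV // gt_eqF ?flat_gt0.
Qed.

Lemma cutoff0 a r t : 0 < r -> 2 * r <= `|t - a| -> cutoff a r t = 0.
Proof.
move=> r0 tr; rewrite /cutoff; set s := 2 + - _.
suff s0 : s <= 0 by rewrite flat_le0 // mul0r.
rewrite subr_le0 ler_pdivlMr ?mulr_gt0 // -[t + - a]/(t - a) -!expr2.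
rewrite -[(t - a) ^+ 2]real_normK ?num_real //.
have : (2 * r) ^+ 2 <= `|t - a| ^+ 2 by rewrite ler_pXn2r // nnegrE mulr_ge0 // ltW.
apply: le_trans; rewrite exprMn; apply: ler_wpM2r; first exact: sqr_ge0.
by rewrite expr2; lra.
Qed.

Definition square (z : R * R) (r : R) : set (R * R) :=
  `[z.1 - r, z.1 + r] `*` `[z.2 - r, z.2 + r].

Lemma squareP z r y : square z r y <-> `|y.1 - z.1| <= r /\ `|y.2 - z.2| <= r.
Proof. by rewrite /square /setX /= !in_itv /= !ler_distl. Qed.

Lemma square_compact z r : compact (square z r).
Proof. by apply: compact_setX; exact: segment_compact. Qed.

Lemma square_closed z r : closed (square z r).
Proof.
apply: closedI; apply: closed_comp => [y _|]; [exact: cvg_fst|exact: itv_closed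
  |exact: cvg_snd|exact: itv_closed].
Qed.

Definition plateau (z : R * R) (r : R) (x y : R) : C :=
  (cutoff z.1 r x * cutoff z.2 r y)%:C.

Lemma plateau_smooth z r : smooth (plateau z r).
Proof.
apply: (@smooth_real _ (fun x y => cutoff z.1 r x * cutoff z.2 r y)) => k.
exact: (RCkM (RCk_cutoff _ _ (RCk_x _ k)) (RCk_cutoff _ _ (RCk_y _ k))).
Qed.

Lemma plateau1 z r y : 0 < r -> square z r y -> plateau z r y.1 y.2 = 1.
Proof. by move=> r0 /squareP[h1 h2]; rewrite /plateau !cutoff1 // mulr1. Qed.

Lemma plateau_supp z r y : 0 < r -> plateau z r y.1 y.2 != 0 -> square z (2 * r) y.
Proof.
move=> r0 b0; apply/squareP; rewrite !leNgt; split; apply/negP => /ltW h.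
  by move: b0; rewrite /plateau (cutoff0 r0 h) mul0r eqxx.
by move: b0; rewrite /plateau (cutoff0 r0 h) mulr0 eqxx.
Qed.

Lemma fsupp_sub f A : closed A ->
  (forall z, f z.1 z.2 != 0 -> A z) -> fsupp f `<=` A.
Proof.
by move=> /closure_id cA H; rewrite cA; apply: closure_subset => z; exact: H.
Qed.

Lemma fsuppM f g : fsupp (fun x y => f x y * g x y) `<=` fsupp f.
Proof. by apply: closure_subset => z /=; rewrite mulf_eq0 negb_or => /andP[]. Qed.

Lemma fsuppMr f g : fsupp (fun x y => f x y * g x y) `<=` fsupp g.
Proof. by apply: closure_subset => z /=; rewrite mulf_eq0 negb_or => /andP[]. Qed.

Lemma test_plateau z r : 0 < r -> test_fun (plateau z r).
Proof.
move=> r0; split; first exact: plateau_smooth.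
apply: (@subclosed_compact _ _ (square z (2 * r))).
- exact: closed_closure.
- exact: square_compact.
- apply: fsupp_sub; first exact: square_closed.
  by move=> y; exact: plateau_supp.
Qed.

Lemma test_funM f g : test_fun f -> smooth g ->
  test_fun (fun x y => f x y * g x y).
Proof.
move=> [sf cf] sg; split; first exact: smoothM.
apply: (@subclosed_compact _ _ (fsupp f)) => //; first exact: closed_closure.
exact: fsuppM.
Qed.

Lemma test_funD f g : test_fun f -> test_fun g ->
  test_fun (fun x y => f x y + g x y).
Proof.
move=> [sf cf] [sg cg]; split; first exact: smoothD.
apply: (@subclosed_compact _ _ (fsupp f `|` fsupp g)).
- exact: closed_closure.
- exact: compactU.
- apply: fsupp_sub; first by apply: closedU; exact: closed_closure.
  move=> z; have [f0|f0 _] := eqVneq (f z.1 z.2) 0.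
    by rewrite f0 add0r => g0; right; apply: subset_closure.
  by left; apply: subset_closure.
Qed.

Lemma test_funZ (c : C) f : test_fun f -> test_fun (fun x y => c * f x y).
Proof.
move=> [sf cf]; split; first exact: smoothM (smooth_cst c) sf.
apply: (@subclosed_compact _ _ (fsupp f)) => //; first exact: closed_closure.
exact: fsuppMr.
Qed.

Lemma test_fun0 : test_fun (fun _ _ : R => 0 : C).
Proof.
split; first exact: smooth_cst.
suff -> : fsupp (fun _ _ : R => 0 : C) = set0 by exact: compact0.
by rewrite -subset0; apply: fsupp_sub => [|z]; [exact: closed0|rewrite eqxx].
Qed.

Lemma dapp0 w : w (fun _ _ => 0) = 0.
Proof.
have := @dapp_linear _ w 1 _ _ test_fun0 test_fun0.
rewrite !mul1r addr0 => /eqP.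
by rewrite -[X in X == _]addr0 => /eqP/addrI.
Qed.

Lemma dappD w f g : test_fun f -> test_fun g ->
  w (fun x y => f x y + g x y) = w f + w g.
Proof.
move=> tf tg; have := dapp_linear w 1 tf tg; rewrite mul1r => <-.
by under [in RHS]eq_fun do under eq_fun do rewrite mul1r.
Qed.

End Cutoffs.

(** * Pairing distributions with functions smooth near their support *)

Section Support.
Variable R : realType.
Local Notation C := R[i].
Implicit Types (f g : R -> R -> C) (w : schwartz_distribution R).

(** The cover characterization of compactness applies to pointed topological
    spaces, whence the structure packed by hand on the product. *)
Lemma compact_prod_cover (A : set (R * R)) : compact A -> cover_compact A.
Proof.
pose RR := HB.pack_for ptopologicalType (R * R)%type
  (Topological.on (R * R)%type) (Pointed.on (R * R)%type).
by have := @compact_cover RR => /(congr1 (fun P => P A)) => <-.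
Qed.

Lemma open_square (U : set (R * R)) z : open U -> U z ->
  exists2 r : R, 0 < r & square z (2 * r) `<=` U.
Proof.
move=> oU Uz; have /nbhs_ballP[e /= e0 eU] : nbhs z U by exact: open_nbhs_nbhs.
exists (e / 4); first by rewrite divr_gt0.
move=> y /squareP[h1 h2]; apply: eU; split; rewrite /ball /= distrC.
  by apply: le_lt_trans h1 _; lra.
by apply: le_lt_trans h2 _; lra.
Qed.

(** On each listed square [w] does not see [f * plateau], so [f] may be multiplied
    by [1 - plateau] without changing [w f]; after all the squares have been
    treated the function vanishes on their union.  Iterating such products avoids
    the division that a partition of unity would require. *)
Lemma dapp_off_squares w (s : seq ((R * R) * R)) f :
  (forall zr, zr \in s -> 0 < zr.2 /\
     exists2 U, vanishes_on w U & square zr.1 (2 * zr.2) `<=` U) ->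
  test_fun f ->
  exists g, [/\ test_fun g, w g = w f &
    forall y, (exists2 zr, zr \in s & square zr.1 zr.2 y) \/ f y.1 y.2 = 0 ->
      g y.1 y.2 = 0].
Proof.
elim: s f => [|zr s IH] f Hs tf.
  by exists f; split=> // y [[?]|].
have [r0 [U wU sU]] := Hs zr (mem_head _ _).
pose b := plateau zr.1 zr.2; pose f1 x y := f x y * (1 + -1 * b x y).
have tb : test_fun b by exact: test_plateau.
have sb : smooth b by exact: plateau_smooth.
have tf1 : test_fun f1.
  apply: test_funM => //; apply: smoothD; first exact: smooth_cst.
  by apply: smoothM; first exact: smooth_cst.
have tf2 : test_fun (fun x y => f x y * b x y) by exact: test_funM.
have [|g [tg wg g0]] := IH f1 _ tf1.
  by move=> zr' zr's; apply: Hs; rewrite inE zr's orbT.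
exists g; split=> //.
  have -> : f = (fun x y => f1 x y + f x y * b x y).
    by apply/funext => x; apply/funext => y; rewrite /f1; ring.
  have bU : fsupp b `<=` U.
    apply: (subset_trans _ sU); apply: fsupp_sub; first exact: square_closed.
    by move=> y; exact: plateau_supp.
  by rewrite dappD // [X in _ + X]wU ?addr0 // => z /fsuppMr /bU.
move=> y H; apply: g0; case: H => [[zr']|fy].
  rewrite inE => /predU1P[->|zr's] sy; last by left; exists zr'.
  by right; rewrite /f1 /b plateau1 // mulN1r subrr mulr0.
by right; rewrite /f1 fy mul0r.
Qed.

(** A distribution vanishes off its support, although the support is defined only
    as the complement of the union of the open sets where it vanishes: finitely
    many squares inside such open sets cover the compact [fsupp f]. *)
Lemma dapp_off_dsupp w f : test_fun f -> fsupp f `<=` ~` dsupp w -> w f = 0.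
Proof.
move=> tf fw.
pose D := [set zr : (R * R) * R | 0 < zr.2 /\
     exists2 U, vanishes_on w U & square zr.1 (2 * zr.2) `<=` U].
pose B (zr : (R * R) * R) := ball zr.1 zr.2.
have cf : cover_compact (fsupp f) by case: tf => _ /compact_prod_cover.
have [||s sD fs] := cf _ D B.
- by move=> zr [r0 _]; exact: ball_open.
- move=> z /fw; rewrite /dsupp setCK => -[U [oU wU] Uz].
  have [r r0 rU] := open_square oU Uz.
  by exists (z, r); [split => //; exists U|exact: ballxx].
have [|g [tg <- g0]] := @dapp_off_squares w (finmap.enum_fset s) f _ tf.
  by move=> zr /sD; rewrite inE.
suff -> : g = (fun _ _ => 0) by exact: dapp0.
apply/funext => x; apply/funext => y; apply: (g0 (x, y)).
have [->|f0] := eqVneq (f x y) 0; [by right|left].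
have /fs [zr zrs zrB] : fsupp f (x, y) by exact: subset_closure.
exists zr => //; apply/squareP; case: zrB => /= h1 h2.
by split; rewrite distrC ltW.
Qed.

(** The functions to which [kpair] applies: those extending, from some
    neighbourhood of [A], to a globally smooth function. *)
Definition smooth_near (A : set (R * R)) f : Prop :=
  exists2 g, smooth g & agree_near A f g.

Lemma smooth_nearW A f : smooth f -> smooth_near A f.
Proof.
by move=> sf; exists f => //; exists setT; split => //; exact: openT.
Qed.

Lemma smooth_near_sub A B f : A `<=` B -> smooth_near B f -> smooth_near A f.
Proof.
move=> AB [g sg [U [oU BU fg]]]; exists g => //; exists U; split=> //.
exact: subset_trans BU.
Qed.

Lemma agree_near2 (op : C -> C -> C) A f f' g g' :
  agree_near A f f' -> agree_near A g g' ->
  agree_near A (fun x y => op (f x y) (g x y)) (fun x y => op (f' x y) (g' x y)).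
Proof.
move=> [U [oU AU fU]] [V [oV AV gV]]; exists (U `&` V); split.
- exact: openI.
- by move=> z Az; split; [exact: AU|exact: AV].
- by move=> z [Uz Vz]; rewrite fU // gV.
Qed.

Lemma smooth_nearD A f g : smooth_near A f -> smooth_near A g ->
  smooth_near A (fun x y => f x y + g x y).
Proof.
move=> [f' sf ff'] [g' sg gg']; exists (fun x y => f' x y + g' x y).
  exact: smoothD.
exact: (agree_near2 +%R).
Qed.

Lemma smooth_nearM A f g : smooth_near A f -> smooth_near A g ->
  smooth_near A (fun x y => f x y * g x y).
Proof.
move=> [f' sf ff'] [g' sg gg']; exists (fun x y => f' x y * g' x y).
  exact: smoothM.
exact: (agree_near2 *%R).
Qed.

Lemma smooth_near_sum A (I : Type) (s : seq I) (F : I -> R -> R -> C) :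
  (forall i, smooth_near A (F i)) ->
  smooth_near A (fun x y => \sum_(i <- s) F i x y).
Proof.
move=> H; elim: s => [|i s IH].
  by under eq_fun do under eq_fun do rewrite big_nil;
     apply: smooth_nearW; exact: smooth_cst.
under eq_fun do under eq_fun do rewrite big_cons.
exact: smooth_nearD.
Qed.

(** A smooth extension multiplied by a plateau around the bounded set [A] is a test
    function. *)
Lemma test_near A f : bounded_set A -> smooth_near A f ->
  exists2 g, test_fun g & agree_near A f g.
Proof.
move=> bA [g sg fg].
(* boundedness controls norms by the bounds above M only, and the ball is open *)
have [M M0 AM] : exists2 M : R, 0 < M & A `<=` ball ((0, 0) : R * R) M.
  have [M [_ /(_ (`|M| + 1)) H]] := bA.
  have h : M < `|M| + 1 by rewrite (le_lt_trans (ler_norm M)) // ltrDl.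
  exists (`|M| + 2); first by rewrite ltr_wpDl.
  move=> z /(H h) /= zM; rewrite /ball /= /prod_ball /= /ball /= !sub0r !normrN.
  move: zM; rewrite prod_normE ge_max => /andP[z1 z2].
  by split; apply: le_lt_trans; first [exact: z1|exact: z2|rewrite ltrD2l ltr1n].
pose b := plateau ((0, 0) : R * R) M.
exists (fun x y => b x y * g x y); first exact: test_funM (test_plateau _ M0) sg.
have [U [oU AU fU]] := fg.
exists (U `&` ball ((0, 0) : R * R) M); split.
- by apply: openI => //; exact: ball_open.
- by move=> z Az; split; [exact: AU|exact: AM].
- move=> z [Uz /= [h1 h2]]; rewrite fU // /b plateau1 ?mul1r //.
  by apply/squareP; split; rewrite distrC ltW.
Qed.

(** [kpair] does not depend on the test function chosen: two choices differ by a
    test function supported off [dsupp w]. *)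
Lemma kpairE w f g : test_fun g -> agree_near (dsupp w) f g -> kpair w f = w g.
Proof.
move=> tg fg; rewrite /kpair.
have /(xgetPex (fun _ _ => 0)) : exists g,
  [set g | test_fun g /\ agree_near (dsupp w) f g] g by exists g.
set h := xget _ _ => -[th fh].
have tgh : test_fun (fun x y => h x y + -1 * g x y).
  by apply: test_funD => //; exact: test_funZ.
have : w (fun x y => h x y + -1 * g x y) = 0.
  apply: dapp_off_dsupp => // z.
  have [U [oU wU fU]] := fh; have [V [oV wV gV]] := fg.
  move=> zs zw; have := zs (U `&` V) _.
  case.
    apply: open_nbhs_nbhs; split; first exact: openI.
    by split; [exact: wU|exact: wV].
  by move=> y [/= /eqP + [Uy Vy]]; rewrite -fU // -gV // mulN1r subrr.
rewrite dappD //; last exact: test_funZ.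
have -> : w (fun x y => -1 * g x y) = - w g.
  have := dapp_linear w (-1) tg (test_fun0 R); rewrite dapp0 addr0 mulN1r => <-.
  by under [in RHS]eq_fun do under eq_fun do rewrite addr0.
by move/eqP; rewrite subr_eq0 => /eqP.
Qed.

Lemma kpair_linear w (c : C) f g : bounded_set (dsupp w) ->
  smooth_near (dsupp w) f -> smooth_near (dsupp w) g ->
  kpair w (fun x y => c * f x y + g x y) = c * kpair w f + kpair w g.
Proof.
move=> bw /(test_near bw)[f' tf ff'] /(test_near bw)[g' tg gg'].
rewrite (kpairE tf ff') (kpairE tg gg') -dapp_linear //; apply: kpairE.
  by apply: test_funD => //; exact: test_funZ.
exact: (agree_near2 (fun a b => c * a + b)).
Qed.

End Support.

(** * Sesquilinear forms of matrix kernels *)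

Section Kernels.
Variables (R : realType) (p : nat).
Local Notation C := R[i].
Local Notation mpoly := 'M[{poly C}]_p.
Implicit Types (w : schwartz_distribution R) (t u v : 'M[schwartz_distribution R]_p).
Implicit Types (P Q : matfun R p).

Lemma kpair_lincomb w (I : Type) (s : seq I) (c : I -> C)
    (f : I -> R -> R -> C) (g : R -> R -> C) : bounded_set (dsupp w) ->
  (forall m, smooth_near (dsupp w) (f m)) -> smooth_near (dsupp w) g ->
  kpair w (fun x y => \sum_(m <- s) c m * f m x y + g x y) =
  \sum_(m <- s) c m * kpair w (f m) + kpair w g.
Proof.
move=> bw sf sg; elim: s => [|m s IH].
  rewrite big_nil add0r; congr kpair.
  by apply/funext => x; apply/funext => y; rewrite big_nil add0r.
rewrite big_cons -addrA -IH -kpair_linear //; last first.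
  apply: smooth_nearD => //; apply: smooth_near_sum => i.
  by apply: smooth_nearM => //; apply: smooth_nearW; exact: smooth_cst.
congr kpair; apply/funext => x; apply/funext => y.
by rewrite big_cons addrA.
Qed.

Lemma dapp_sum w (I : Type) (s : seq I) (f : I -> R -> R -> C) :
  (forall i, test_fun (f i)) ->
  w (fun x y => \sum_(i <- s) f i x y) = \sum_(i <- s) w (f i).
Proof.
move=> tf; suff [] : test_fun (fun x y => \sum_(i <- s) f i x y) /\
  w (fun x y => \sum_(i <- s) f i x y) = \sum_(i <- s) w (f i) by [].
elim: s => [|i s [ts IH]].
  rewrite big_nil; under eq_fun do under eq_fun do rewrite big_nil.
  by split; [exact: test_fun0|rewrite dapp0].
rewrite big_cons; under eq_fun do under eq_fun do rewrite big_cons.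
by rewrite dappD // IH; split => //; exact: test_funD.
Qed.

Lemma kpair_agree w f g : bounded_set (dsupp w) -> smooth_near (dsupp w) g ->
  agree_near (dsupp w) f g -> kpair w f = kpair w g.
Proof.
move=> bw sg fg; have [h th gh] := test_near bw sg.
rewrite (kpairE th gh); apply: kpairE => //.
have [U [oU AU fU]] := fg; have [V [oV AV gV]] := gh.
exists (U `&` V); split; first exact: openI.
  by move=> z wz; split; [exact: AU|exact: AV].
by move=> z [Uz Vz]; rewrite fU // gV.
Qed.

Lemma bounded_set_sub (A B : set (R * R)) :
  A `<=` B -> bounded_set B -> bounded_set A.
Proof.
by move=> AB [M [Mr H]]; exists M; split=> // x Mx z /AB; exact: H.
Qed.

Lemma dsupp_msupp u k l : dsupp (u k l) `<=` msupp u.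
Proof. by move=> z; exists (k, l). Qed.

Lemma msupp_closed u : closed (msupp u).
Proof.
apply: closed_bigcup => [|ij _]; first exact: finite_finset.
apply: open_closedC.
by apply: bigcup_open => U [].
Qed.

Lemma msupp_bounded u : generalized_kernel u -> bounded_set (msupp u).
Proof.
move=> [_ [M1 [M1r H1]] [M2 [M2r H2]]]; exists (Num.max M1 M2); split.
  exact: num_real.
move=> M; rewrite gt_max => /andP[M1M M2M] z uz /=.
rewrite prod_normE ge_max; apply/andP; split.
  by apply: (H1 _ M1M); exists z.
by apply: (H2 _ M2M); exists z.
Qed.

Lemma msupp_compact u : generalized_kernel u -> compact (msupp u).
Proof.
move=> gu; have [M [_ /(_ (M + 1))]] := msupp_bounded gu.
rewrite ltrDl ltr01 => /(_ isT) H.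
apply: (@subclosed_compact _ _ (square (0, 0) (M + 1))).
- exact: msupp_closed.
- exact: square_compact.
- move=> z /H /=; rewrite prod_normE ge_max => /andP[h1 h2].
  by apply/squareP; rewrite !subr0.
Qed.

Definition smoothx u P := forall i k, smooth_near (msupp u) (fun x _ => P x i k).
Definition smoothy u Q := forall j l, smooth_near (msupp u) (fun _ y => Q y j l).

Lemma smooth_kernel u P Q i j k l k' l' : smoothx u P -> smoothy u Q ->
  smooth_near (dsupp (u k' l')) (fun x y => P x i k * Q y j l).
Proof.
move=> sP sQ; apply: (smooth_near_sub (@dsupp_msupp u k' l')).
exact: smooth_nearM (sP i k) (sQ j l).
Qed.

Lemma kform_linl u (A : 'M[C]_p) P P' Q : bounded_set (msupp u) ->
  smoothx u P -> smoothx u P' -> smoothy u Q ->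
  kform u (fun x => A *m P x + P' x) Q = A *m kform u P Q + kform u P' Q.
Proof.
move=> bu sP sP' sQ; apply/matrixP => i j; rewrite !mxE.
under [X in _ = X + _]eq_bigr do rewrite !mxE mulr_sumr.
rewrite [X in _ = X + _]exchange_big -big_split /=; apply: eq_bigr => k _.
under [X in _ = X + _]eq_bigr do rewrite mulr_sumr.
rewrite [X in _ = X + _]exchange_big -big_split /=; apply: eq_bigr => l _.
rewrite -[RHS](@kpair_lincomb _ _ _ (A i) (fun m x y => P x m k * Q y j l)
  (fun x y => P' x i k * Q y j l)); last 3 first.
- exact: bounded_set_sub (@dsupp_msupp u k l) bu.
- by move=> m; apply: smooth_kernel.
- exact: smooth_kernel.
congr kpair; apply/funext => x; apply/funext => y.
by rewrite !mxE mulrDl mulr_suml; congr (_ + _); apply: eq_bigr => m _; rewrite mulrA.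
Qed.

Lemma kform_linr u (B : 'M[C]_p) P Q Q' : bounded_set (msupp u) ->
  smoothx u P -> smoothy u Q -> smoothy u Q' ->
  kform u P (fun y => B *m Q y + Q' y) = kform u P Q *m B^T + kform u P Q'.
Proof.
move=> bu sP sQ sQ'; apply/matrixP => i j; rewrite !mxE.
under [X in _ = X + _]eq_bigr do rewrite !mxE mulr_suml.
rewrite [X in _ = X + _]exchange_big -big_split /=; apply: eq_bigr => k _.
under [X in _ = X + _]eq_bigr do rewrite mulr_suml.
rewrite [X in _ = X + _]exchange_big -big_split /=; apply: eq_bigr => l _.
under [X in _ = X + _]eq_bigr do rewrite mulrC.
rewrite -[RHS](@kpair_lincomb _ _ _ (B j) (fun m x y => P x i k * Q y m l)
  (fun x y => P x i k * Q' y j l)); last 3 first.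
- exact: bounded_set_sub (@dsupp_msupp u k l) bu.
- by move=> m; apply: smooth_kernel.
- exact: smooth_kernel.
congr kpair; apply/funext => x; apply/funext => y.
by rewrite !mxE mulrDr mulr_sumr; congr (_ + _); apply: eq_bigr => m _; rewrite mulrCA.
Qed.

Lemma mpfun_smoothx u (W : mpoly) : smoothx u (mpfun W).
Proof.
move=> i k; apply: smooth_nearW.
under eq_fun do under eq_fun do rewrite mxE.
apply: smooth_horner; exact: smooth_x.
Qed.

Lemma mpfun_smoothy u (W : mpoly) : smoothy u (mpfun W).
Proof.
move=> i k; apply: smooth_nearW.
under eq_fun do under eq_fun do rewrite mxE.
apply: smooth_horner; exact: smooth_y.
Qed.

Lemma smoothyM u Q Q' : smoothy u Q -> smoothy u Q' ->
  smoothy u (fun y => Q y *m Q' y).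
Proof.
move=> sQ sQ' j l; under eq_fun do under eq_fun do rewrite mxE.
by apply: smooth_near_sum => m; apply: smooth_nearM.
Qed.

Lemma smoothyT u Q : smoothy u Q -> smoothy u (fun y => (Q y)^T).
Proof. by move=> sQ j l; under eq_fun do under eq_fun do rewrite mxE. Qed.

Lemma mevalM m n q (V : 'M[{poly C}]_(m, n)) (W : 'M[{poly C}]_(n, q)) z :
  meval (V *m W) z = meval V z *m meval W z.
Proof.
apply/matrixP => i j; rewrite !mxE horner_sum.
by apply: eq_bigr => k _; rewrite hornerM !mxE.
Qed.

Lemma mevalD m n (V W : 'M[{poly C}]_(m, n)) z :
  meval (V + W) z = meval V z + meval W z.
Proof. by apply/matrixP => i j; rewrite !mxE hornerD. Qed.

Lemma mevalC m n (A : 'M[C]_(m, n)) z : meval (map_mx polyC A) z = A.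
Proof. by apply/matrixP => i j; rewrite !mxE hornerC. Qed.

Lemma meval_tr (W : mpoly) z : meval W^T z = (meval W z)^T.
Proof. by apply/matrixP => i j; rewrite !mxE. Qed.

Lemma meval_map (W : mpoly) (z : C) : meval W z = map_mx (horner_eval z) W.
Proof. by apply/matrixP => i j; rewrite !mxE. Qed.

Lemma det_meval (W : mpoly) (z : C) : \det (meval W z) = (\det W).[z].
Proof. by rewrite meval_map det_map_mx. Qed.

Lemma adj_meval (W : mpoly) (z : C) : \adj (meval W z) = meval (\adj W) z.
Proof. by rewrite !meval_map map_mx_adj. Qed.

(** The image of the compact set under |f|^2 is closed and misses 0, hence misses a
    ball around 0; half of its radius is a bound valid on a neighbourhood. *)
Lemma nonvanishing_near (K : set (R * R)) (f : R -> R -> C) :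
  compact K -> smooth f -> (forall z, K z -> f z.1 z.2 != 0) ->
  exists (e : R) (U : set (R * R)), [/\ 0 < e, open U, K `<=` U &
    forall z, U z ->
      e <= complex.Re (f z.1 z.2) ^+ 2 + complex.Im (f z.1 z.2) ^+ 2].
Proof.
move=> cK /smoothP /(_ 0%N) [f1 f2] f0.
pose q x y := complex.Re (f x y) * complex.Re (f x y) +
              complex.Im (f x y) * complex.Im (f x y).
have cq := RCk_cont (RCkD (RCkM f1 f1) (RCkM f2 f2)).
rewrite -/q in cq.
pose q' z := q z.1 z.2.
have clK : closed (q' @` K).
  apply: compact_closed; first exact: Rhausdorff.
  apply: continuous_compact => //; exact: continuous_subspaceT.
have q0 : (~` (q' @` K)) 0.
  move=> [z /f0 fz] /eqP; rewrite /q' /q -!expr2 paddr_eq0 ?sqr_ge0 // !sqrf_eq0.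
  by move: fz; rewrite eq_complex /= => /negP h /h.
have : nbhs (0 : R) (~` (q' @` K)).
  by apply: open_nbhs_nbhs; split => //; exact: closed_openC.
move=> /nbhs_ballP[e /= e0 eU].
exists (e / 2), (q' @^-1` [set t | e / 2 < t]); split.
- by rewrite divr_gt0.
- by apply: open_comp; [move=> z _; exact: cq|exact: open_gt].
- move=> z Kz /=; rewrite ltNge; apply/negP => qe.
  have : (q' @` K) (q' z) by exists z.
  apply: (eU); rewrite /ball /= sub0r normrN ger0_norm; last first.
    by rewrite /q' /q addr_ge0 // -expr2 sqr_ge0.
  by apply: le_lt_trans qe _; lra.
- by move=> z /=; rewrite /q' /q -!expr2 => /ltW.
Qed.

Lemma mpfun_lin (A : 'M[C]_p) (V W : mpoly) :
  mpfun (map_mx polyC A *m V + W) = fun x => A *m mpfun V x + mpfun W x.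
Proof. by apply/funext => x; rewrite /mpfun mevalD mevalM mevalC. Qed.

Lemma kform_poly_linl t (A : 'M[C]_p) (P P' Q : mpoly) :
  generalized_kernel t ->
  kform t (mpfun (map_mx polyC A *m P + P')) (mpfun Q) =
  A *m kform t (mpfun P) (mpfun Q) + kform t (mpfun P') (mpfun Q).
Proof.
move=> gw; rewrite mpfun_lin kform_linl //; first exact: msupp_bounded.
- exact: mpfun_smoothx.
- exact: mpfun_smoothx.
- exact: mpfun_smoothy.
Qed.

Lemma kform_poly_linr t (B : 'M[C]_p) (P Q Q' : mpoly) :
  generalized_kernel t ->
  kform t (mpfun P) (mpfun (map_mx polyC B *m Q + Q')) =
  kform t (mpfun P) (mpfun Q) *m B^T + kform t (mpfun P) (mpfun Q').
Proof.
move=> gw; rewrite mpfun_lin kform_linr //; first exact: msupp_bounded.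
- exact: mpfun_smoothx.
- exact: mpfun_smoothy.
- exact: mpfun_smoothy.
Qed.

Section Geronimus.
Variables (u v : 'M[schwartz_distribution R]_p) (WG : mpoly).
Hypothesis gu : generalized_kernel u.
Hypothesis gv : generalized_kernel v.
Hypothesis WGu : spectrum WG `&` [set y%:C | y in suppy u] = set0.
Hypothesis vWG : annihilated_by v (mpfun WG).

Let winv := fun y : R => invmx (mpfun WG y).

Lemma det_WG_bounded_below : exists (e : R) (U : set (R * R)),
  [/\ 0 < e, open U, msupp u `<=` U &
    forall z, U z -> let d := (\det WG).[z.2%:C] in
      e <= complex.Re d ^+ 2 + complex.Im d ^+ 2].
Proof.
apply: (@nonvanishing_near _ (fun _ y => (\det WG).[y%:C])).
- exact: msupp_compact.
- by apply: smooth_horner; exact: smooth_y.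
move=> z uz /=; apply/eqP => d0.
have : (spectrum WG `&` [set y%:C | y in suppy u]) z.2%:C.
  by split; [rewrite /spectrum /= det_meval|exists z.2 => //; exists z].
by rewrite WGu.
Qed.

Lemma WG_invertible_near : exists U : set (R * R),
  [/\ open U, msupp u `<=` U & forall z, U z -> mpfun WG z.2 \in unitmx].
Proof.
have [e [U [e0 oU uU Ue]]] := det_WG_bounded_below; exists U; split=> // z /Ue /=.
move=> h; rewrite unitmxE unitfE det_meval; apply: contraTneq h => ->.
by rewrite /= expr0n addr0 -ltNge.
Qed.

(** W_G^-1 is the adjugate divided by the determinant, which is bounded away from
    0 near the support of [u]; this gives sense to the form of u W_G^-1. *)
Lemma winv_smoothy : smoothy u winv.
Proof.
move=> j l; have [e [U [e0 oU uU Ue]]] := det_WG_bounded_below.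
have [V [oV uV Vunit]] := WG_invertible_near.
have sd : smooth (fun _ y : R => (\det WG).[y%:C]).
  by apply: smooth_horner; exact: smooth_y.
have [g sg gE] := smooth_inv_away e0 sd.
exists (fun x y => g x y * (\adj WG j l).[y%:C]).
  by apply: smoothM => //; apply: smooth_horner; exact: smooth_y.
exists (U `&` V); split; first exact: openI.
  by move=> z uz; split; [exact: uU|exact: uV].
move=> z [Uz Vz]; rewrite gE; last exact: Ue.
by rewrite /winv /invmx Vunit // /mpfun adj_meval det_meval !mxE.
Qed.

Local Notation ucheck := (geronimus_form u v WG).

Lemma geronimus_linl (A : 'M[C]_p) (P P' Q : mpoly) :
  ucheck (mpfun (map_mx polyC A *m P + P')) (mpfun Q) =
  A *m ucheck (mpfun P) (mpfun Q) + ucheck (mpfun P') (mpfun Q).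
Proof.
rewrite /geronimus_form /Defs.formD kform_poly_linl // mulmxDr addrACA; congr (_ + _).
rewrite /formMr mpfun_lin kform_linl //; first exact: msupp_bounded.
- exact: mpfun_smoothx.
- exact: mpfun_smoothx.
- apply: smoothyM; first exact: mpfun_smoothy.
  by apply: smoothyT; exact: winv_smoothy.
Qed.

Lemma geronimus_linr (B : 'M[C]_p) (P Q Q' : mpoly) :
  ucheck (mpfun P) (mpfun (map_mx polyC B *m Q + Q')) =
  ucheck (mpfun P) (mpfun Q) *m B^T + ucheck (mpfun P) (mpfun Q').
Proof.
rewrite /geronimus_form /Defs.formD kform_poly_linr // mulmxDl addrACA; congr (_ + _).
have sw (Q0 : mpoly) : smoothy u (fun y => mpfun Q0 y *m (invmx (mpfun WG y))^T).
  apply: smoothyM; first exact: mpfun_smoothy.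
  by apply: smoothyT; exact: winv_smoothy.
rewrite /formMr mpfun_lin -kform_linr //; [|exact: msupp_bounded|exact: mpfun_smoothx].
by congr kform; apply/funext => y; rewrite mulmxDl mulmxA.
Qed.

(** The polynomial factors are first replaced by test functions with the same
    values near the support of [v], since v W_G = 0 is an identity about test
    functions. *)
Lemma kform_annihilated (P Q : mpoly) :
  kform v (mpfun P) (fun y => mpfun Q y *m (mpfun WG y)^T) = 0.
Proof.
apply/matrixP => i j; rewrite !mxE; apply: big1 => k _.
have bv := msupp_bounded gv.
have H m : smooth_near (msupp v) (fun x y => mpfun P x i k * mpfun Q y j m).
  by apply: smooth_nearM; [exact: mpfun_smoothx|exact: mpfun_smoothy].
have /boolp.choice[g gP] : forall m, exists g, test_fun g /\
    agree_near (msupp v) (fun x y => mpfun P x i k * mpfun Q y j m) g.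
  by move=> m; have [g tg ag] := test_near bv (H m); exists g.
have tM m l : test_fun (fun x y => mpfun WG y l m * g m x y).
  have [tg _] := gP m.
  under eq_fun do under eq_fun do rewrite mulrC.
  apply: test_funM => //; under eq_fun do under eq_fun do rewrite mxE.
  by apply: smooth_horner; exact: smooth_y.
transitivity (\sum_l \sum_m v k l (fun x y => mpfun WG y l m * g m x y)).
  apply: eq_bigr => l _; rewrite -dapp_sum //; apply: kpairE.
    have tD (s : seq 'I_p) : test_fun
        (fun x y => \sum_(m <- s) mpfun WG y l m * g m x y).
      elim: s => [|m s IH].
        under eq_fun do under eq_fun do rewrite big_nil; exact: test_fun0.
      under eq_fun do under eq_fun do rewrite big_cons; exact: test_funD.
    exact: tD.
  pose E := [set z | forall m, mpfun P z.1 i k * mpfun Q z.2 j m = g m z.1 z.2].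
  exists E^°; split; first exact: open_interior.
    move=> z /dsupp_msupp vz; apply: (@filter_forall _ _ (fun m y =>
      mpfun P y.1 i k * mpfun Q y.2 j m = g m y.1 y.2) (nbhs z)) => m.
    have [_ [V [oV vV gV]]] := gP m.
    by apply: (filterS gV); apply: open_nbhs_nbhs; split; [|exact: vV].
  move=> z /interior_subset Ez; rewrite [X in _ * X]mxE mulr_sumr.
  apply: eq_bigr => m _; rewrite -Ez [X in _ * (_ * X)]mxE; ring.
by rewrite exchange_big big1 // => m _; apply: vWG; have [] := gP m.
Qed.

(** The relation u = ucheck W_G, which turns orthogonality for [u] into a statement
    on the form of ucheck. *)
Lemma kform_geronimus (P Q : mpoly) :
  kform u (mpfun P) (mpfun Q) = ucheck (mpfun P) (mpfun (Q *m WG^T)).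
Proof.
have WT : mpfun (Q *m WG^T) = fun y => mpfun Q y *m (mpfun WG y)^T.
  apply/funext => y; rewrite /mpfun mevalM; congr (_ *m _).
  by apply/matrixP => a b; rewrite !mxE.
rewrite /geronimus_form /Defs.formD /formMr WT kform_annihilated addr0.
apply/matrixP => i j; rewrite !mxE.
apply: eq_bigr => k _; apply: eq_bigr => l _; symmetry; apply: kpair_agree.
- exact: bounded_set_sub (@dsupp_msupp u k l) (msupp_bounded gu).
- by apply: smooth_kernel; [exact: mpfun_smoothx|exact: mpfun_smoothy].
have [U [oU uU Uu]] := WG_invertible_near; exists U; split=> //.
  by move=> z uz; apply: uU; exact: dsupp_msupp uz.
by move=> z /Uu h; rewrite -mulmxA -trmx_mul mulVmx // trmx1 mulmx1.
Qed.

End Geronimus.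
End Kernels.

(** * Matrix polynomials and left-linear maps *)

Section LeftLinear.
Variables (R : realType) (p : nat).
Local Notation C := R[i].
Local Notation mpoly := 'M[{poly C}]_p.
Local Notation cst_mx := (map_mx (@polyC C)).

(** Coefficients, evaluations, jets and moments of a matrix polynomial all have
    this property; identities between matrix polynomials with constant left
    coefficients can be transported through any of them. *)
Definition left_linear q (J : mpoly -> 'M[C]_(p, q)) : Prop :=
  forall (A : 'M[C]_p) (P P' : mpoly),
    J (cst_mx A *m P + P') = A *m J P + J P'.

Section Theory.
Variables (q : nat) (J : mpoly -> 'M[C]_(p, q)).
Hypothesis JL : left_linear J.

Lemma left_linearD P P' : J (P + P') = J P + J P'.
Proof. by have := JL 1%:M P P'; rewrite map_mx1 !mul1mx. Qed.

Lemma left_linear0 : J 0 = 0.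
Proof.
have /eqP := left_linearD 0 0; rewrite addr0 -[X in X == _]addr0.
by move/eqP/addrI.
Qed.

Lemma left_linearM A P : J (cst_mx A *m P) = A *m J P.
Proof. by have := JL A P 0; rewrite left_linear0 !addr0. Qed.

Lemma left_linear_sum n (c : nat -> 'M[C]_p) (P : nat -> mpoly) :
  J (\sum_(k < n) cst_mx (c k) *m P k) = \sum_(k < n) c k *m J (P k).
Proof.
elim: n => [|n IH]; first by rewrite !big_ord0 left_linear0.
by rewrite !big_ord_recr /= left_linearD IH left_linearM.
Qed.

End Theory.

Lemma mcoef_left_linear k : left_linear (fun P : mpoly => mcoef P k).
Proof.
move=> A P P'; apply/matrixP => i j; rewrite !mxE coefD coef_sum; congr (_ + _).
by apply: eq_bigr => l _; rewrite !mxE coefCM.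
Qed.

Lemma meval_left_linear z : left_linear (fun P : mpoly => meval P z).
Proof. by move=> A P P'; rewrite mevalD mevalM mevalC. Qed.

Definition xpow (k : nat) : mpoly := ('X^k)%:M.

Lemma monomial_mpfun k : @monomial R p k = mpfun (xpow k).
Proof.
apply/funext => x; apply/matrixP => i j.
by rewrite !mxE hornerMn hornerXn.
Qed.

Lemma mcoef_xpow k l : mcoef (xpow k) l = (k == l)%:R%:M.
Proof.
apply/matrixP => i j; rewrite !mxE coefMn coefXn eq_sym.
by case: (i == j); rewrite ?mulr0n.
Qed.

Lemma bopE (S : bmx R p) n :
  bop S n = \sum_(k < n.+1) cst_mx (S n k) *m xpow k.
Proof. by apply: eq_bigr => k _; rewrite mul_mx_scalar. Qed.

Lemma mcoef_bop (S : bmx R p) n k :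
  mcoef (bop S n) k = if (k < n.+1)%N then S n k else 0.
Proof.
rewrite bopE (left_linear_sum (mcoef_left_linear k)).
under eq_bigr do rewrite mcoef_xpow.
case: ltnP => kn; last first.
  by apply: big1 => l _; rewrite ltn_eqF ?(leq_trans _ kn) // raddf0 mulmx0.
rewrite (bigD1 (Ordinal kn)) //= eqxx mulmx1 big1 ?addr0 // => l lk.
have -> : (l == k :> nat) = false.
  by apply: contraNF lk => /eqP lk; apply/eqP/val_inj.
by rewrite raddf0 mulmx0.
Qed.

Definition deg_lt (P : mpoly) (m : nat) : Prop :=
  forall k, (m <= k)%N -> mcoef P k = 0.

Lemma mcoef_eq0 (P : mpoly) : (forall k, mcoef P k = 0) -> P = 0.
Proof.
move=> H; apply/matrixP => i j; rewrite !mxE; apply/polyP => k.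
by have := congr1 (fun M : 'M[C]_p => M i j) (H k); rewrite !mxE coef0.
Qed.

Lemma deg_lt_bop (S : bmx R p) n : deg_lt (bop S n) n.+1.
Proof. by move=> k nk; rewrite mcoef_bop ltnNge nk. Qed.

Lemma mcoef_bop_lead (S : bmx R p) n :
  block_unitriangular S -> mcoef (bop S n) n = 1%:M.
Proof. by move=> [S1 _]; rewrite mcoef_bop leqnn S1. Qed.

Lemma deg_ltS_sub (S : bmx R p) P n : block_unitriangular S ->
  deg_lt P n.+1 -> deg_lt (P - cst_mx (mcoef P n) *m bop S n) n.
Proof.
move=> uS Pn k nk; rewrite addrC -mulNmx -map_mxN.
rewrite (mcoef_left_linear k) mulNmx.
case: (ltngtP n k) nk => // [nk _|<- _]; last by rewrite mcoef_bop_lead // mulmx1 addNr.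
by rewrite deg_lt_bop // mulmx0 oppr0 add0r Pn.
Qed.

(** The polynomials S chi, being monic of each degree, form a basis over constant
    matrices acting on the left: subtract the leading term and iterate. *)
Lemma bop_expansion (S : bmx R p) P m : block_unitriangular S ->
  deg_lt P m -> exists c : nat -> 'M[C]_p,
    P = \sum_(k < m) cst_mx (c k) *m bop S k.
Proof.
move=> uS; elim: m P => [|m IH] P Pm.
  by exists (fun=> 0); rewrite big_ord0; apply: mcoef_eq0 => k; exact: Pm.
have [c Pc] := IH _ (deg_ltS_sub uS Pm).
exists (fun k => if k == m then mcoef P m else c k).
rewrite big_ord_recr /= eqxx -[LHS](subrK (cst_mx (mcoef P m) *m bop S m)) Pc.
by congr (_ + _); apply: eq_bigr => k _; rewrite ltn_eqF.
Qed.

Lemma mcoef_mul (P Q : mpoly) a b : deg_lt P a.+1 -> deg_lt Q b.+1 ->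
  deg_lt (P *m Q) (a + b).+1 /\
  mcoef (P *m Q) (a + b) = mcoef P a *m mcoef Q b.
Proof.
move=> Pa Qb.
have E k : mcoef (P *m Q) k = \sum_(l < k.+1) mcoef P l *m mcoef Q (k - l).
  apply/matrixP => i j; rewrite !mxE coef_sum summxE.
  under eq_bigr do rewrite coefM.
  rewrite exchange_big; apply: eq_bigr => l _ /=.
  by rewrite mxE; apply: eq_bigr => m _; rewrite !mxE.
split.
  move=> k abk; rewrite E; apply: big1 => l _.
  have [al|la] := leqP a.+1 l; first by rewrite Pa // mul0mx.
  by rewrite [X in _ *m X]Qb ?mulmx0 // ltn_subRL (leq_ltn_trans _ abk) // leq_add2r.
have la : (a < (a + b).+1)%N by rewrite ltnS leq_addr.
rewrite E (bigD1 (Ordinal la)) //= addKn big1 ?addr0 // => l lneq.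
case: (ltngtP l a) => la'.
- rewrite [X in _ *m X]Qb ?mulmx0 // ltn_subRL ltn_add2r //.
- by rewrite Pa // mul0mx.
- by case/eqP: lneq; apply: val_inj.
Qed.

End LeftLinear.

(** * Gauss-Borel factorization and biorthogonality *)

Section GaussBorel.
Variables (R : realType) (p : nat).
Local Notation C := R[i].
Variables (G S1 S2 : bmx R p) (H : nat -> 'M[C]_p).
Hypothesis Gdet : forall k, (0 < k)%N -> \det (btrunc G k) != 0.
Hypothesis GB : gauss_borel G S1 H S2.

(** The inverse of a singular matrix is, by convention, that matrix itself, so a
    factorization of a nonsingular truncation forces all factors to be units. *)
Lemma btrunc_unit k : (0 < k)%N ->
  [/\ btrunc S1 k \in unitmx, btrunc (bdiag H) k \in unitmx &
      btrunc S2 k \in unitmx].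
Proof.
move=> /Gdet; rewrite -unitfE -unitmxE; case: GB => _ _ ->.
by rewrite !unitmx_mul unitmx_tr !unitmx_inv => /andP[/andP[-> ->] ->].
Qed.

(** A left kernel of the block [H k] would extend by zero to a left kernel of the
    block diagonal truncation. *)
Lemma gauss_borel_unit k : H k \in unitmx.
Proof.
have [_ Hu _] := btrunc_unit (ltn0Sn k).
rewrite -row_free_unit -kermx_eq0; apply/eqP.
pose x := \mxrow_(j < k.+1) (if j == ord_max then kermx (H k) else 0).
have : x *m btrunc (bdiag H) k.+1 = 0.
  rewrite /x /btrunc mul_mxrow_mxblock -[RHS]mxrow0; apply/eq_mxrowP => j.
  rewrite (bigD1 ord_max) //= eqxx big1 ?addr0 => [|i /negPf ->]; last first.
    by rewrite mul0mx.
  by rewrite /bdiag /=; case: eqP; rewrite ?mulmx_ker ?mulmx0.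
move/(congr1 (mulmx^~ (invmx (btrunc (bdiag H) k.+1)))).
rewrite mulmxK // mul0mx => /(congr1 (fun y => submxrow y ord_max)).
by rewrite mxrowK eqxx => ->; apply/matrixP => i j; rewrite !mxE.
Qed.

Lemma gauss_borel_biorth n m :
  \sum_(k < n.+1) \sum_(l < m.+1) S1 n k *m G k l *m (S2 m l)^T =
  if n == m then H n else 0.
Proof.
pose N := (maxn n m).+1.
have [u1 _ u2] := btrunc_unit (ltn0Sn (maxn n m)).
have : btrunc S1 N *m btrunc G N *m (btrunc S2 N)^T = btrunc (bdiag H) N.
  have [_ _ ->] := GB; rewrite -!mulmxA mulKVmx // -trmx_mul mulmxV //.
  by rewrite trmx1 mulmx1.
have nN : (n < N)%N by rewrite ltnS leq_maxl.
have mN : (m < N)%N by rewrite ltnS leq_maxr.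
rewrite /btrunc tr_mxblock !mul_mxblock => /eq_mxblockP.
move=> /(_ (Ordinal nN) (Ordinal mN)) /=; rewrite /bdiag /= => <-.
have [[_ t1] [_ t2] _] := GB.
(* triangularity lets both sums run up to the common truncation size *)
rewrite exchange_big (big_ord_widen N (fun l => \sum_(k < n.+1)
  S1 n k *m G k l *m (S2 m l)^T)) //.
rewrite big_mkcond; apply: eq_bigr => l _.
case: ltnP => lm; last by rewrite t2 // trmx0 mulmx0.
rewrite mulmx_suml (big_ord_widen N (fun k => S1 n k *m G k l *m (S2 m l)^T)) //.
rewrite big_mkcond; apply: eq_bigr => k _.
by case: ltnP => // kn; rewrite t1 // !mul0mx.
Qed.

End GaussBorel.

Section Biorthogonal.
Variables (R : realType) (p : nat).
Local Notation C := R[i].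
Local Notation mpoly := 'M[{poly C}]_p.
Local Notation cst_mx := (map_mx (@polyC C)).
Variables (F : mpoly -> mpoly -> 'M[C]_p).
Hypothesis Fl : forall Q, left_linear (F^~ Q).
Hypothesis Fr : forall P, left_linear (fun Q => (F P Q)^T).
Variables (S1 S2 : bmx R p) (H : nat -> 'M[C]_p).
Let G : bmx R p := fun k l => F (@xpow R p k) (@xpow R p l).
Hypothesis Gdet : forall k, (0 < k)%N -> \det (btrunc G k) != 0.
Hypothesis GB : gauss_borel G S1 H S2.

Let uS1 : block_unitriangular S1. Proof. by case: GB. Qed.
Let uS2 : block_unitriangular S2. Proof. by case: GB. Qed.

Lemma biorthogonal n m :
  F (bop S1 n) (bop S2 m) = if n == m then H n else 0.
Proof.
rewrite -(gauss_borel_biorth Gdet GB) bopE (left_linear_sum (Fl _)).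
apply: eq_bigr => k _; rewrite bopE.
have /(congr1 trmx) := left_linear_sum (Fr (@xpow R p k)) m.+1 (S2 m) (@xpow R p).
rewrite trmxK => ->; rewrite linear_sum mulmx_sumr; apply: eq_bigr => l _.
by rewrite /= trmx_mul trmxK mulmxA.
Qed.

Lemma form_left_expansion m (c : nat -> 'M[C]_p) j : (j < m)%N ->
  F (\sum_(k < m) cst_mx (c k) *m bop S1 k) (bop S2 j) = c j *m H j.
Proof.
move=> jm; rewrite (left_linear_sum (Fl _)) (bigD1 (Ordinal jm)) //=.
rewrite biorthogonal eqxx big1 ?addr0 // => k /negPf kj.
by rewrite biorthogonal -[_ == _]/(k == Ordinal jm) kj mulmx0.
Qed.

Lemma form_right_expansion m (c : nat -> 'M[C]_p) j : (j < m)%N ->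
  F (bop S1 j) (\sum_(k < m) cst_mx (c k) *m bop S2 k) = H j *m (c j)^T.
Proof.
move=> jm; apply: trmx_inj; rewrite (left_linear_sum (Fr _)).
rewrite trmx_mul trmxK (bigD1 (Ordinal jm)) //=.
rewrite biorthogonal eqxx big1 ?addr0 // => k /negPf kj.
by rewrite biorthogonal eq_sym -[_ == _]/(k == Ordinal jm) kj trmx0 mulmx0.
Qed.

(** Only the term of degree [n] of the expansion of [Q] in the second family
    contributes. *)
Lemma form_right_lead n Q : deg_lt Q n.+1 ->
  F (bop S1 n) Q = H n *m (mcoef Q n)^T.
Proof.
move=> Qn; have [c Qc] := bop_expansion uS2 Qn.
rewrite [in LHS]Qc form_right_expansion //; congr (_ *m _^T).
rewrite Qc big_ord_recr /= (left_linearD (mcoef_left_linear n)).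
rewrite (left_linearM (mcoef_left_linear n)) mcoef_bop_lead // mulmx1.
rewrite (left_linear_sum (mcoef_left_linear n)) big1 ?add0r // => k _.
by rewrite mcoef_bop ltnS leqNgt ltn_ord mulmx0.
Qed.

(** Expand [Q] in the second family: the sum defining the kernel restores each
    coefficient at the point [y]. *)
Lemma CDkernel_reproducing n y Q : deg_lt Q n.+1 ->
  F (CDkernel S1 H S2 n y) Q = (meval Q y)^T.
Proof.
move=> Qn; have [c Qc] := bop_expansion uS2 Qn.
rewrite {2}Qc (left_linear_sum (meval_left_linear y)) linear_sum.
rewrite (left_linear_sum (Fl _) _
  (fun k => (meval (bop S2 k) y)^T *m invmx (H k))).
apply: eq_bigr => k _; rewrite {1}Qc form_right_expansion //= trmx_mul.
rewrite mulmxA -(mulmxA _ (invmx _)) mulVmx ?mulmx1 //.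
exact: gauss_borel_unit Gdet GB k.
Qed.

Lemma CDkernel_orth n y : F (CDkernel S1 H S2 n y) (bop S2 n.+1) = 0.
Proof.
rewrite (left_linear_sum (Fl _) _
  (fun k => (meval (bop S2 k) y)^T *m invmx (H k))).
apply: big1 => k _; rewrite biorthogonal ltn_eqF ?mulmx0 //.
Qed.

Lemma deg_lt_CDkernel n y : deg_lt (CDkernel S1 H S2 n y) n.+1.
Proof.
move=> k nk; rewrite (left_linear_sum (mcoef_left_linear k) _
  (fun k => (meval (bop S2 k) y)^T *m invmx (H k))).
apply: big1 => l _; rewrite deg_lt_bop ?mulmx0 //.
exact: leq_trans (ltn_ord l) nk.
Qed.

End Biorthogonal.

(** * Spectral jets *)

Section Jets.
Variables (R : realType) (p : nat).
Local Notation C := R[i].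
Local Notation mpoly := 'M[{poly C}]_p.
Local Notation cst_mx := (map_mx (@polyC C)).

Lemma jet_left_linear (D : root_data R p) : left_linear (jet D).
Proof.
move=> A P P'; rewrite /jet mul_mxrow -mxrowD; apply/eq_mxrowP => a.
rewrite mul_mxrow -mxrowD; apply/eq_mxrowP => j; apply/matrixP => i m.
rewrite [LHS]mxE mulmxDl -mulmxA [X in X^`N(m)]mxE nderivnD hornerD.
rewrite [RHS]mxE [X in _ = _ + X]mxE; congr (_ + _).
rewrite [RHS]mxE [X in X^`N(m)]mxE linear_sum horner_sum; apply: eq_bigr => k _.
by rewrite [in RHS]mxE [map_mx _ _ _ _]mxE mul_polyC /= nderivnZ hornerZ.
Qed.

(** In characteristic 0 the divided derivatives are the derivatives up to nonzero
    factorials, and each derivation lowers the order of a zero by one. *)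
Lemma nderivn_root (f : {poly C}) a k m : (m < k)%N ->
  ('X - a%:P) ^+ k %| f -> f^`N(m).[a] = 0.
Proof.
move=> mk kf; suff H : ('X - a%:P) ^+ (k - m) %| f^`(m).
  have : f^`(m).[a] = 0.
    apply/rootP; rewrite root_factor_theorem; apply: dvdp_trans H.
    by rewrite -[(k - m)%N]prednK ?subn_gt0 // exprS dvdp_mulr.
  rewrite nderivn_def hornerMn => /eqP; rewrite mulrn_eq0 => /orP[|/eqP //].
  by rewrite eqn0Ngt fact_gt0.
elim: m {mk} => [|m IH]; first by rewrite subn0.
rewrite derivnS subnS; case: (k - m)%N IH => [|d] /=.
  by move=> _; rewrite expr0 dvd1p.
move=> /dvdpP[g ->]; rewrite derivM deriv_exp derivXsubC mul1r /= dvdp_add //.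
  by rewrite exprS dvdp_mull // dvdp_mull.
by rewrite dvdp_mull // -mulr_natl dvdp_mull.
Qed.

(** The root polynomials are killed by [W] up to the order of the jet. *)
Lemma jet_mul0 (W : mpoly) N (D : root_data R p) (P : mpoly) :
  canonical_root_data W N D -> jet D (P *m W) = 0.
Proof.
move=> [_ _ _ Wr _]; rewrite /jet -[RHS]mxrow0; apply/eq_mxrowP => a.
rewrite -[RHS]mxrow0; apply/eq_mxrowP => j; apply/matrixP => i m.
rewrite [LHS]mxE [RHS]mxE.
apply: nderivn_root (ltn_ord m) _; rewrite -mulmxA mxE.
apply: (big_ind (fun f => _ %| f)) => [|f g|k _].
- exact: dvdp0.
- exact: dvdp_add.
- exact: dvdp_mull (Wr a j k).
Qed.

End Jets.

(** * Connection formulas *)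

Section Darboux.
Variables (R : realType) (p : nat).
Local Notation C := R[i].
Local Notation mpoly := 'M[{poly C}]_p.
Local Notation cst_mx := (map_mx (@polyC C)).
Variables (Fc : mpoly -> mpoly -> 'M[C]_p).
Hypothesis Fl : forall Q, left_linear (Fc^~ Q).
Hypothesis Fr : forall P, left_linear (fun Q => (Fc P Q)^T).
Variables (NC NG n : nat) (WC WG : mpoly) (A : 'M[C]_p).
Hypothesis WCdeg : monic_deg WC NC.
Hypothesis WGdeg : has_deg_lead WG NG A.
Hypothesis NG0 : (0 < NG)%N.
Hypothesis NGn : (NG <= n)%N.
Let Fu P Q := Fc P (Q *m WG^T).
Let Fh P Q := Fc (P *m WC) Q.
Variables (S1 S2 Sh1 Sh2 : bmx R p) (H Hh : nat -> 'M[C]_p).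
Let Gu : bmx R p := fun k l => Fu (@xpow R p k) (@xpow R p l).
Let Gh : bmx R p := fun k l => Fh (@xpow R p k) (@xpow R p l).
Hypothesis Gudet : forall k, (0 < k)%N -> \det (btrunc Gu k) != 0.
Hypothesis Ghdet : forall k, (0 < k)%N -> \det (btrunc Gh k) != 0.
Hypothesis GBu : gauss_borel Gu S1 H S2.
Hypothesis GBh : gauss_borel Gh Sh1 Hh Sh2.

Let Ful Q : left_linear (Fu^~ Q). Proof. by move=> B P P'; exact: Fl. Qed.

Let Fur P : left_linear (fun Q => (Fu P Q)^T).
Proof. by move=> B Q Q'; rewrite /Fu mulmxDl -mulmxA Fr. Qed.

Let Fhl Q : left_linear (Fh^~ Q).
Proof. by move=> B P P'; rewrite /Fh mulmxDl -mulmxA Fl. Qed.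

Let Fhr P : left_linear (fun Q => (Fh P Q)^T).
Proof. by move=> B Q Q'; exact: Fr. Qed.

Let uS1 : block_unitriangular S1. Proof. by case: GBu. Qed.
Let uS2 : block_unitriangular S2. Proof. by case: GBu. Qed.
Let uSh1 : block_unitriangular Sh1. Proof. by case: GBh. Qed.
Let uSh2 : block_unitriangular Sh2. Proof. by case: GBh. Qed.

Lemma deg_lt_WC : deg_lt WC NC.+1. Proof. by case: WCdeg => _ _ H0 k; exact: H0. Qed.

Lemma mcoef_tr (W : mpoly) k : mcoef W^T k = (mcoef W k)^T.
Proof. by apply/matrixP => i j; rewrite !mxE. Qed.

Lemma deg_lt_WGT : deg_lt WG^T NG.+1.
Proof. by case: WGdeg => _ _ H0 k k0; rewrite mcoef_tr H0 // trmx0. Qed.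

(** Pairing with the second family reads off the coefficients on the first one, so
    orthogonality below [n - NG] leaves only the indices [n - NG] to [n + NC]; the
    corresponding polynomials head the rows of the quasideterminants. *)
Lemma window_expansion (T : mpoly) : deg_lt T (n + NC).+1 ->
  (forall j, (j < n - NG)%N -> Fu T (bop S2 j) = 0) ->
  exists2 t : nat -> 'M[C]_p,
    T = cst_mx (mcoef T (n + NC)) *m bop S1 (n + NC) +
        \sum_(i < NC + NG) cst_mx (t i) *m bop S1 (n - NG + i) &
    t 0%N *m H (n - NG) = Fu T (bop S2 (n - NG)).
Proof.
move=> Tdeg T0; have := deg_ltS_sub uS1 Tdeg; set lead := _ *m bop S1 (n + NC).
move=> /(bop_expansion uS1) [c Tc].
have cF j : (j < n + NC)%N -> c j *m H j = Fu T (bop S2 j).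
  move=> jn; rewrite -(form_left_expansion Ful Fur Gudet GBu c jn) -Tc.
  rewrite -mulNmx -map_mxN addrC (Ful (bop S2 j)).
  by rewrite (biorthogonal Ful Fur Gudet GBu) gtn_eqF // mulmx0 add0r.
exists (fun i => c (n - NG + i)%N); last first.
  by rewrite addn0 cF // (leq_trans _ (leq_addr _ _)) // ltn_subrL NG0 (leq_trans NG0).
rewrite -[LHS](subrK lead) addrC Tc; congr (_ + _).
(* indices below the window have zero coefficient *)
have -> : (n + NC = n - NG + (NC + NG))%N.
  by rewrite addnCA subnK // addnC.
rewrite big_split_ord /= big1 ?add0r // => j _.
have -> : c j = 0; last by rewrite map_mx0 mul0mx.
have Hj := gauss_borel_unit Gudet GBu j.
rewrite -[c j](mulmxK Hj) cF ?T0 ?mul0mx //.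
by rewrite (leq_trans (ltn_ord j)) // (leq_trans (leq_subr _ _)) // leq_addr.
Qed.

Lemma window_apply q (J : mpoly -> 'M[C]_(p, q)) (B : 'M[C]_p)
    (t : nat -> 'M[C]_p) : left_linear J ->
  J (cst_mx B *m bop S1 (n + NC) +
     \sum_(i < NC + NG) cst_mx (t i) *m bop S1 (n - NG + i)) =
  B *m J (bop S1 (n + NC)) +
  (\mxrow_(i < NC + NG) t i) *m \mxcol_(i < NC + NG) J (bop S1 (n - NG + i)).
Proof.
move=> JL; rewrite JL mul_mxrow_mxcol; congr (_ + _).
exact: (left_linear_sum JL _ t (fun i => bop S1 (n - NG + i))).
Qed.

Variables (D : root_data R p).
Hypothesis WCroots : canonical_root_data WC NC D.

(** The row of spectral jets and first [n] moments whose values at the first family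
    are the rows of [Phi]. *)
Definition jet_moment (P : mpoly) : 'M[C]_(p, jet_dim D + \sum_(l < n) p) :=
  row_mx (jet D P) (\mxrow_(l < n) Fc P (@xpow R p l)).

Lemma jet_moment_left_linear : left_linear jet_moment.
Proof.
move=> B P P'; rewrite /jet_moment (jet_left_linear D) mul_mx_row add_row_mx.
congr row_mx; rewrite mul_mxrow -mxrowD; apply/eq_mxrowP => l; exact: Fl.
Qed.

Variable sel : 'I_(\sum_(i < NC + NG) p) -> 'I_(jet_dim D + \sum_(l < n) p).
Let Phi : 'M[C]_(\sum_(i < NC + NG) p, _) :=
  \mxcol_(i < NC + NG) jet_moment (bop S1 (n - NG + i)).
Hypothesis PhiU : colsub sel Phi \in unitmx.
Let phi := jet_moment (bop S1 (n + NC)).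
Let Hcol : 'M[C]_(\sum_(i < NC + NG) p, p) :=
  \mxcol_(i < NC + NG) (if i == 0 :> nat then H (n - NG)%N else 0).

Lemma mul_first_block_col (t : nat -> 'M[C]_p) :
  (\mxrow_(i < NC + NG) t i) *m Hcol = t 0%N *m H (n - NG).
Proof.
have N0 : (0 < NC + NG)%N by rewrite addn_gt0 NG0 orbT.
rewrite /Hcol mul_mxrow_mxcol (bigD1 (Ordinal N0)) //= big1 ?addr0 // => i i0.
case: eqP => [e|_]; last by rewrite mulmx0.
by case/eqP: i0; apply: val_inj.
Qed.

Lemma hat_moment l : (l <= n)%N ->
  Fc (bop Sh1 n *m WC) (@xpow R p l) = if l == n then Hh n else 0.
Proof.
move=> ln; rewrite -/(Fh (bop Sh1 n) (@xpow R p l)).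
rewrite (form_right_lead Fhl Fhr Ghdet GBh) => [|k nk]; last first.
  by rewrite mcoef_xpow ltn_eqF ?raddf0 // (leq_ltn_trans ln).
rewrite mcoef_xpow; case: eqP => _; first by rewrite trmx1 mulmx1.
by rewrite raddf0 trmx0 mulmx0.
Qed.

Lemma bop_mul_WGT j : deg_lt (bop S2 j *m WG^T) (j + NG).+1 /\
  mcoef (bop S2 j *m WG^T) (j + NG) = A^T.
Proof.
have [d ->] := mcoef_mul (@deg_lt_bop _ _ S2 j) deg_lt_WGT; split=> //.
by rewrite mcoef_bop_lead // mul1mx mcoef_tr; case: WGdeg => ->.
Qed.

(** The polynomial hat P_n W_C has vanishing spectral jets by [jet_mul0] and
    vanishing first [n] moments by orthogonality for uhat.  Applying [jet_moment] to
    its window expansion gives 0 = phi + t Phi, which determines the coefficients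
    [t] on any nonsingular selection of columns.  Its form against P_(n - NG) only
    sees the leading coefficient [A] of W_G. *)
Lemma first_kind_window : exists t : nat -> 'M[C]_p,
  [/\ \mxrow_(i < NC + NG) t i = - (colsub sel phi *m invmx (colsub sel Phi)),
      t 0%N *m H (n - NG) = Hh n *m A &
      forall q (J : mpoly -> 'M[C]_(p, q)), left_linear J ->
        J (bop Sh1 n *m WC) = J (bop S1 (n + NC)) +
        (\mxrow_(i < NC + NG) t i) *m
          \mxcol_(i < NC + NG) J (bop S1 (n - NG + i))].
Proof.
have [Tdeg Tlead] := mcoef_mul (@deg_lt_bop _ _ Sh1 n) deg_lt_WC.
have {}Tlead : mcoef (bop Sh1 n *m WC) (n + NC) = 1%:M.
  by rewrite Tlead mcoef_bop_lead // mul1mx; case: WCdeg.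
have TF j : Fu (bop Sh1 n *m WC) (bop S2 j) = Fh (bop Sh1 n) (bop S2 j *m WG^T).
  by [].
have [|t TE t0] := window_expansion Tdeg.
  move=> j jn; have jn' : (j + NG < n)%N by rewrite -ltn_subRL ltn_subCr // in jn *.
  have [d _] := bop_mul_WGT j.
  rewrite TF (form_right_lead Fhl Fhr Ghdet GBh) => [|k nk].
    by rewrite d ?trmx0 ?mulmx0.
  by rewrite d // (leq_trans jn') // ltnW.
have E q (J : mpoly -> 'M[C]_(p, q)) : left_linear J ->
    J (bop Sh1 n *m WC) = J (bop S1 (n + NC)) + (\mxrow_(i < NC + NG) t i) *m
          \mxcol_(i < NC + NG) J (bop S1 (n - NG + i)).
  by move=> JL; rewrite {1}TE window_apply // Tlead mul1mx.
exists t; split=> //.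
  have := E _ _ jet_moment_left_linear.
  have -> : jet_moment (bop Sh1 n *m WC) = 0.
    rewrite /jet_moment (jet_mul0 _ WCroots) -[RHS]row_mx0; congr row_mx.
    rewrite -[RHS]mxrow0; apply/eq_mxrowP => l.
    by rewrite hat_moment 1?ltnW // ltn_eqF.
  move=> /eqP; rewrite eq_sym addr_eq0 => /eqP/(congr1 (colsub sel)).
  rewrite -/Phi -/phi => e.
  rewrite e linearN /= -mulmx_colsub mulNmx opprK mulmxK //.
rewrite t0 TF (form_right_lead Fhl Fhr Ghdet GBh); last first.
  by move=> k; have [d _] := bop_mul_WGT (n - NG); rewrite subnK // in d; exact: d.
have [_] := bop_mul_WGT (n - NG); rewrite subnK // => ->.
by rewrite trmxK.
Qed.

Section SecondKind.
Variable y : C.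
Let K := CDkernel S1 H S2 n.-1 y.
Let Kh := CDkernel Sh1 Hh Sh2 n.-1 y.
Let n0 : (0 < n)%N. Proof. exact: leq_trans NGn. Qed.
(** W_G(y) K_(n-1)(x, y) - hat K_(n-1)(x, y) W_C(x), as a polynomial in x.  Both
    kernels reproduce low degrees, so the defect is orthogonal to the beginning of
    the second family; since hat K W_C has zero jets and reproduces the monomials
    y^l, its jets and moments make up the row [phiK]. *)
Definition kernel_defect : mpoly := cst_mx (meval WG y) *m K - Kh *m WC.
Local Notation T := kernel_defect.

Lemma left_linear_defect q (J : mpoly -> 'M[C]_(p, q)) : left_linear J ->
  J T = meval WG y *m J K - J (Kh *m WC).
Proof.
move=> JL; rewrite /T JL -[- (Kh *m WC)]mul1mx -(map_mx1 (@polyC C)).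
rewrite mulmxN -mulNmx -map_mxN (left_linearM JL) mulNmx mul1mx //.
Qed.

Lemma hat_kernel_reproducing Q : deg_lt Q n -> Fh Kh Q = (meval Q y)^T.
Proof.
move=> Qn; apply: (CDkernel_reproducing Fhl Fhr Ghdet GBh).
by rewrite prednK.
Qed.

Lemma Fu_defect j : (j < n)%N -> Fu T (bop S2 j) =
  (meval (bop S2 j *m WG^T) y)^T - Fh Kh (bop S2 j *m WG^T).
Proof.
move=> jn; rewrite (left_linear_defect (Ful (bop S2 j))); congr (_ - _).
rewrite mevalM meval_tr trmx_mul trmxK; congr (_ *m _).
apply: (CDkernel_reproducing Ful Fur Gudet GBu); rewrite prednK // => k nk.
by rewrite deg_lt_bop // (leq_trans jn).
Qed.

(** Against P_(n - NG), the product P_(n - NG) W_G^T has degree exactly [n], one more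
    than what hat K_(n-1) reproduces; the missing part is A^T times hat P_n of the
    second kind, and this is the only place where it enters. *)
Lemma second_kind_window : exists t : nat -> 'M[C]_p,
  [/\ t 0%N *m H (n - NG) = (meval (bop Sh2 n) y)^T *m A &
      forall q (J : mpoly -> 'M[C]_(p, q)), left_linear J ->
        J T = (\mxrow_(i < NC + NG) t i) *m
          \mxcol_(i < NC + NG) J (bop S1 (n - NG + i))].
Proof.
have Kdeg : deg_lt K n by rewrite -[X in deg_lt _ X](prednK n0); exact: deg_lt_CDkernel.
have Khdeg : deg_lt Kh n.-1.+1 by exact: deg_lt_CDkernel.
have Tdeg : deg_lt T (n + NC).
  move=> k nk; rewrite (left_linear_defect (mcoef_left_linear k)).
  have [d _] := mcoef_mul Khdeg deg_lt_WC.
  rewrite d; last by rewrite -addSn prednK.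
  by rewrite Kdeg ?mulmx0 ?subr0 // (leq_trans _ nk) // leq_addr.
have [||t TE t0] := @window_expansion T.
- by move=> k nk; apply: Tdeg; exact: ltnW.
- move=> j jn; have jn' : (j + NG < n)%N by rewrite -ltn_subRL ltn_subCr // in jn *.
  rewrite Fu_defect ?(leq_ltn_trans (leq_addr NG j)) // hat_kernel_reproducing ?subrr //.
  by have [d _] := bop_mul_WGT j => k nk; apply: d; exact: leq_trans nk.
exists t; split; last first.
  move=> q J JL; rewrite {1}TE window_apply // (Tdeg (n + NC)%N) // mul0mx add0r //.
rewrite t0 Fu_defect ?ltn_subrL ?NG0 //.
set Q := bop S2 (n - NG) *m WG^T.
have [Qdeg Qlead] := bop_mul_WGT (n - NG); rewrite subnK // -/Q in Qdeg Qlead.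
(* split off the term of degree n, to which the kernel is orthogonal *)
have := deg_ltS_sub uSh2 Qdeg; rewrite Qlead.
set Q' := Q - _ => Q'deg.
have QE : Q = cst_mx A^T *m bop Sh2 n + Q' by rewrite /Q' addrC subrK.
have -> : Fh Kh Q = (meval Q' y)^T.
  apply: trmx_inj; rewrite QE (Fhr Kh) -(hat_kernel_reproducing Q'deg).
  have := CDkernel_orth Fhl Fhr Ghdet GBh n.-1 y; rewrite prednK // => ->.
  by rewrite trmx0 mulmx0 add0r.
rewrite QE (meval_left_linear y) linearD /= addrK trmx_mul trmxK //.
Qed.

End SecondKind.

End Darboux.

(** * Quasideterminantal formulas *)

Theorem theorem8 (R : realType) (p NC NG n : nat)
  (u v : 'M[schwartz_distribution R]_p)
  (WC WG : 'M[{poly R[i]}]_p) (A : 'M[R[i]]_p)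
  (D : root_data R p)
  (S1 S2 Sh1 Sh2 : bmx R p) (H Hh : nat -> 'M[R[i]]_p)
  (sel : 'I_(\sum_(i < NC + NG) p) -> 'I_(jet_dim D + \sum_(l < n) p))
  (ucheck := geronimus_form u v WG)
  (uhat := formMl (mpfun WC) ucheck)
  (PhiM := Phi D ucheck S1 NC NG n)
  (phi := jetR_row D ucheck S1 n (n + NC))
  (PhiSq := colsub sel PhiM)
  (phiSq := colsub sel phi)
  (Hcol := \mxcol_(i < NC + NG) (if i == 0 :> nat then H (n - NG)%N else 0)) :
  (0 < p)%N ->
  generalized_kernel u ->
  generalized_kernel v ->
  monic_deg WC NC ->
  (0 < NG)%N ->
  has_deg_lead WG NG A ->
  spectrum WG `&` [set y%:C | y in suppy u] = set0 ->
  annihilated_by v (mpfun WG) ->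
  quasidefinite (kform u) ->
  quasidefinite ucheck ->
  quasidefinite uhat ->
  gauss_borel (gram (kform u)) S1 H S2 ->
  gauss_borel (gram uhat) Sh1 Hh Sh2 ->
  canonical_root_data WC NC D ->
  (NG <= n)%N ->
  \rank PhiM = ((NC + NG) * p)%N ->
  PhiSq \in unitmx ->
  [/\ forall x : R[i],
        meval (bop Sh1 n) x *m meval WC x =
        quasidet PhiSq
          (\mxcol_(i < NC + NG) meval (bop S1 (n - NG + i)) x)
          phiSq (meval (bop S1 (n + NC)) x),
      forall y : R[i],
        (meval (bop Sh2 n) y)^T *m A =
        - quasidet PhiSq Hcol (colsub sel (phiK D ucheck WG S1 H S2 n y)) 0,
      Hh n =
        quasidet PhiSq (\mxcol_(i < NC + NG) Rmat ucheck S1 (n - NG + i) n)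
          phiSq (Rmat ucheck S1 (n + NC) n) &
      Hh n *m A = quasidet PhiSq Hcol phiSq 0].
Proof.
move=> p0 gu gv WCm NG0 WGd spec ann qu qc qh GBu GBh WCroots NGn _ PhiU.
pose Fc (P Q : 'M[{poly R[i]}]_p) := ucheck (mpfun P) (mpfun Q).
have Fl Q : left_linear (Fc^~ Q) by move=> B P P'; exact: geronimus_linl.
have Fr P : left_linear (fun Q => (Fc P Q)^T).
  by move=> B Q Q'; rewrite /Fc /ucheck geronimus_linr // linearD /= trmx_mul trmxK.
have Gu : gram (kform u) = fun k l => Fc (@xpow R p k) (@xpow R p l *m WG^T).
  apply/funext => k; apply/funext => l.
  by rewrite /gram !monomial_mpfun (kform_geronimus gu gv spec ann).
have Gh : gram uhat = fun k l => Fc (@xpow R p k *m WC) (@xpow R p l).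
  apply/funext => k; apply/funext => l; rewrite /gram !monomial_mpfun /uhat /formMl /Fc.
  by congr ucheck; apply/funext => x; rewrite /mpfun mevalM.
rewrite /quasidefinite Gu in qu GBu; rewrite /quasidefinite Gh in qh GBh.
have RE k l : Rmat ucheck S1 k l = Fc (bop S1 k) (@xpow R p l).
  by rewrite /Rmat monomial_mpfun.
have rowE k : jetR_row D ucheck S1 n k = jet_moment Fc n D (bop S1 k).
  by congr row_mx; apply/eq_mxrowP => l; exact: RE.
have PhiE : PhiM = \mxcol_(i < NC + NG) jet_moment Fc n D (bop S1 (n - NG + i)).
  by apply/eq_mxcolP => i; exact: rowE.
rewrite /PhiSq PhiE in PhiU; rewrite /phiSq /PhiSq /phi rowE PhiE.
have [t [tE t0 tJ]] := first_kind_window Fl Fr WCm WGd NG0 NGn qu qh GBu GBh WCroots PhiU.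
rewrite -(mul_first_block_col NC n NG0) tE in t0.
(* evaluations and moments of hat P_n W_C are read from its window expansion *)
have qE q (J : 'M[{poly R[i]}]_p -> 'M[R[i]]_(p, q)) : left_linear J ->
    J (bop Sh1 n *m WC) = quasidet (colsub sel
        (\mxcol_(i < NC + NG) jet_moment Fc n D (bop S1 (n - NG + i))))
      (\mxcol_(i < NC + NG) J (bop S1 (n - NG + i)))
      (colsub sel (jet_moment Fc n D (bop S1 (n + NC)))) (J (bop S1 (n + NC))).
  by move=> JL; rewrite tJ // tE mulNmx.
split.
- by move=> x; rewrite -mevalM (qE _ _ (meval_left_linear x)).
- move=> y; have [s [s0 sJ]] := second_kind_window Fl Fr WCm WGd NG0 NGn qu qh GBu GBh y.
  rewrite -s0 -(mul_first_block_col NC n NG0) /quasidet sub0r opprK.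
  suff -> : phiK D ucheck WG S1 H S2 n y = jet_moment Fc n D
      (kernel_defect n WC WG S1 S2 Sh1 Sh2 H Hh y).
    rewrite sJ; last exact: jet_moment_left_linear.
    by rewrite -mulmx_colsub mulmxK.
  have n0 : (0 < n)%N by exact: leq_trans NGn.
  congr row_mx.
    rewrite (left_linear_defect n WC WG S1 S2 Sh1 Sh2 H Hh y (jet_left_linear D)).
    by rewrite (jet_mul0 _ WCroots) subr0.
  apply/eq_mxrowP => l; rewrite (left_linear_defect n WC WG S1 S2 Sh1 Sh2 H Hh y (Fl _)).
  rewrite /rK; congr (_ - _).
    rewrite -(left_linearM (Fl (@xpow R p l))) /Fc -monomial_mpfun; congr ucheck.
    by apply/funext => x; rewrite /mpfun mevalM mevalC.
  have -> : (y ^+ l)%:M = (meval (@xpow R p l) y)^T.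
    by apply/matrixP => i j; rewrite !mxE hornerMn hornerXn eq_sym.
  apply/esym; apply: (hat_kernel_reproducing Fl Fr NG0 NGn qh GBh) => k lk.
  by rewrite mcoef_xpow ltn_eqF ?raddf0 // (leq_trans (ltn_ord l)).
- have -> : \mxcol_(i < NC + NG) Rmat ucheck S1 (n - NG + i) n =
      \mxcol_(i < NC + NG) Fc (bop S1 (n - NG + i)) (@xpow R p n).
    by apply/eq_mxcolP => i; exact: RE.
  rewrite RE.
  by rewrite -(qE _ _ (Fl (@xpow R p n))) (hat_moment Fl Fr qh GBh) // eqxx.
- by rewrite -t0 /quasidet sub0r mulNmx.
Qed.
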